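(* Let $k$ be a field, $d\geq 3$ and $R=k[x_1,\ldots,x_d]$ with the standard grading. The general linear matrix $L$ of order $(d+1)\times d$ over $R$ satisfies the property that the set $\{D_1,\ldots,D_d\}\subset R$ of inversion factors associated to the basic representatives of the inverse map generates an ideal of codimension two with minimal graded free resolution $$0\to R(-d^2)\xrightarrow{\ \mathbf{x}^t\ } R(-(d^2-1))^d\xrightarrow{\ \Psi\ } R(-(d(d-1)-1))^d\to R,$$ where the last map is given by $(D_1,\ldots,D_d)$ (so that this is a resolution of $R/(D_1,\ldots,D_d)$), $\Psi$ denotes the matrix obtained by evaluating every entry of the Jacobian dual matrix of $L$ at the signed $d\times d$ minors of $L$, and $\mathbf{x}^t$ is the transpose of the vector $\mathbf{x}=(x_1,\ldots,x_d)$.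
   Context: A linear matrix of order $(d+1)\times d$ is one whose entries are linear forms in $R$. The parameter space of such matrices is the product of $d(d+1)$ copies of the dual projective space $(\mathbb{P}^{d-1})^*$, each nonzero linear form corresponding to the point given by its coefficients. ''The general linear matrix has a property'' means that the set of parameter points corresponding to matrices having the property contains a dense open subset of this parameter space. Let $\boldsymbol\Delta=(\Delta_1,\ldots,\Delta_{d+1})$ be the ordered signed $d\times d$ minors of $L$, with $\boldsymbol\Delta L=0$; they define a rational map $\mathbb{P}^{d-1}\dashrightarrow\mathbb{P}^{d}$, and $L$ is called homaloidal-like if this map is birational onto its (closed) image (this is so for the general $L$). Let $\mathbf{y}=(y_1,\ldots,y_{d+1})$ be target coordinates and write $\mathbf{y}\,L=(x_1\ \cdots\ x_d)\,B$, where $B$ is a $d\times d$ matrix of linear forms over $k[\mathbf{y}]$. The transpose $B^t$ is the Jacobian dual matrix of $L$; thus $\Psi=B^t(\boldsymbol\Delta)$. For general $L$, each of the $d$ submatrices of $B^t$ of order $(d-1)\times d$ (obtained by omitting one row) yields, through its ordered signed $(d-1)\times(d-1)$ minors $g_1,\ldots,g_d\in k[\mathbf{y}]$, a representative of the inverse map; these $d$ representatives are the basic representatives. For such a representative there is a unique form $D\in R$ such that $g_i(\boldsymbol\Delta)=D\,x_i$ for every $1\leq i\leq d$; $D$ is the inversion factor associated to the representative, and $D_1,\ldots,D_d$ are the inversion factors of the $d$ basic representatives. *)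

(* Defs.v *)
From HB Require Import structures.
From mathcomp Require Import all_boot all_order all_algebra.
From mathcomp Require Import mpoly.

Set Implicit Arguments.
Unset Strict Implicit.
Unset Printing Implicit Defensive.

Import GRing.Theory.
Local Open Scope ring_scope.

(* Codimension (= height) of an ideal, given as a predicate on the ring.      *)

Definition prime_ideal (A : comNzRingType) (P : {pred A}) : Prop :=
  idealr_closed P /\ prime_idealr_closed P.

(* There is a chain Q_0 < Q_1 < ... < Q_n = P of prime ideals. *)
Definition height_ge (A : comNzRingType) (P : {pred A}) (n : nat) : Prop :=
  exists Q : nat -> {pred A},
    [/\ forall i, (i <= n)%N -> prime_ideal (Q i),
        forall i, (i < n)%N ->
          {subset Q i <= Q i.+1} /\ ~ {subset Q i.+1 <= Q i}
      & Q n =i P].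

(* The minimum of the heights of the primes containing I is exactly n; in     *)
(* particular the unit ideal has no codimension.                              *)
Definition has_codim (A : comNzRingType) (I : A -> Prop) (n : nat) : Prop :=
  (forall P : {pred A}, prime_ideal P -> (forall f, I f -> f \in P) ->
     height_ge P n) /\
  (exists P : {pred A},
     [/\ prime_ideal P, forall f, I f -> f \in P & ~ height_ge P n.+1]).

Definition ideal_gen (A : comNzRingType) (n : nat) (D : 'I_n -> A) (f : A) :
  Prop := exists a : 'I_n -> A, f = \sum_j a j * D j.

(* Graded free resolutions.  A matrix M with m rows and n columns is the map  *)
(* of free modules v |-> M *m v on column vectors.                            *)

(* M is a degree-0 map (+)_j R(- b j) -> (+)_i R(- a i).                      *)
Definition graded_map (K : fieldType) (d m n : nat)
    (a : 'I_m -> nat) (b : 'I_n -> nat) (M : 'M[{mpoly K[d]}]_(m, n)) : Prop :=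
  forall i j, if (a i <= b j)%N then M i j \is (b j - a i)%N.-homog
              else M i j == 0.

(* The image of M lies in (x_1, ..., x_d) times the target. *)
Definition minimal_map (K : fieldType) (d m n : nat)
    (M : 'M[{mpoly K[d]}]_(m, n)) : Prop :=
  forall i j, (M i j)@_0%MM = 0.

Definition exact_at (A : comNzRingType) (m n p : nat)
    (M : 'M[A]_(m, n)) (N : 'M[A]_(n, p)) : Prop :=
  forall v : 'cV[A]_n, M *m v = 0 <-> exists w : 'cV[A]_p, v = N *m w.

(* 0 -> (+) R(- s3 j) -f3-> (+) R(- s2 j) -f2-> (+) R(- s1 j) -f1-> R         *)
(* is a minimal graded free resolution of R/I.                                *)
Definition minimal_graded_free_resolution3 (K : fieldType) (d n1 n2 n3 : nat)
    (I : {mpoly K[d]} -> Prop)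
    (s1 : 'I_n1 -> nat) (s2 : 'I_n2 -> nat) (s3 : 'I_n3 -> nat)
    (f1 : 'M[{mpoly K[d]}]_(1, n1)) (f2 : 'M[{mpoly K[d]}]_(n1, n2))
    (f3 : 'M[{mpoly K[d]}]_(n2, n3)) : Prop :=
  [/\ graded_map (fun _ : 'I_1 => 0%N) s1 f1, graded_map s1 s2 f2
    & graded_map s2 s3 f3] /\
  [/\ minimal_map f1, minimal_map f2 & minimal_map f3] /\
  [/\ forall f, I f <-> exists v : 'cV_n1, f%:M = f1 *m v,
      exact_at f1 f2, exact_at f2 f3
    & forall w : 'cV_n3, f3 *m w = 0 -> w = 0].

(* The rational map defined by a linear matrix.                               *)

Section RationalMap.
Variables (K : fieldType) (d : nat) (L : 'M[{mpoly K[d]}]_(d.+1, d)).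

Definition signed_minor (i : 'I_d.+1) : {mpoly K[d]} :=
  (-1) ^+ i * \det (row' i L).

(* Evaluation p(Delta) of p in k[y] at the signed maximal minors of L. *)
Definition at_minors (p : {mpoly K[d.+1]}) : {mpoly K[d]} :=
  p \mPo [tuple signed_minor i | i < d.+1].

(* The homogeneous prime ideal of the closed image of the rational map. *)
Definition image_ideal (p : {mpoly K[d.+1]}) : Prop := at_minors p = 0.

(* Delta is birational onto its closed image Y and g represents the inverse   *)
(* rational map from Y to P^(d-1): the g_i are forms in y of the same degree, *)
(* not all zero on Y; g o Delta is the identity of P^(d-1); Delta o g is      *)
(* defined on Y and is the identity of Y, as rational maps.                   *)
Definition inverse_representative (g : 'I_d -> {mpoly K[d.+1]}) : Prop :=
  let Dg i := signed_minor i \mPo [tuple g j | j < d] in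
  [/\ exists e : nat, forall i, g i \is e.-homog,
      exists i, ~ image_ideal (g i),
      forall i j, 'X_i * at_minors (g j) = 'X_j * at_minors (g i),
      exists i, ~ image_ideal (Dg i)
    & forall i j, image_ideal ('X_i * Dg j - 'X_j * Dg i)].

Definition homaloidal_like : Prop := exists g, inverse_representative g.

(* The matrix B of linear forms in y with y L = x B: its entry (l, j) is the  *)
(* coefficient of x_l in the j-th entry of y L.                               *)
Definition dual_matrix : 'M[{mpoly K[d.+1]}]_d :=
  \matrix_(l, j) \sum_(i < d.+1) (L i j)@_(U_(l))%MM *: 'X_i.

Definition jacobian_dual : 'M[{mpoly K[d.+1]}]_d := dual_matrix^T.

Definition Psi : 'M[{mpoly K[d]}]_d := map_mx at_minors jacobian_dual.

(* The signed minors of the submatrix of B^t omitting row j, signed as the    *)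
(* cofactors of row j in B^t.  The factor (-1)^j does not change the          *)
(* represented rational map; it is the normalization of the inversion factors *)
(* for which (D_1, ..., D_d) * Psi = 0 holds without further signs.           *)
Definition basic_representative (j i : 'I_d) : {mpoly K[d.+1]} :=
  cofactor jacobian_dual j i.

Definition inversion_factor (g : 'I_d -> {mpoly K[d.+1]}) (D : {mpoly K[d]}) :
  Prop :=
  (exists e : nat, D \is e.-homog) /\ (forall i, at_minors (g i) = D * 'X_i).

End RationalMap.

(* The parameter space and general linear matrices.                           *)

(* c i j is the coefficient vector of the linear form in position (i, j). *)
Definition linear_matrix (K : fieldType) (d : nat)
    (c : 'M['rV[K]_d]_(d.+1, d)) : 'M[{mpoly K[d]}]_(d.+1, d) :=
  \matrix_(i, j) \sum_(l < d) c i j 0 l *: 'X_l.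

(* When all c i j are nonzero, c is a system of multihomogeneous coordinates  *)
(* of a point of the product of the d(d+1) dual projective spaces; two such   *)
(* systems represent the same point when they differ by independent scalings. *)
Definition coordinates (K : fieldType) (d : nat)
    (c : 'M['rV[K]_d]_(d.+1, d)) : Prop := forall i j, c i j != 0.

Definition same_point (K : fieldType) (d : nat)
    (c c' : 'M['rV[K]_d]_(d.+1, d)) : Prop :=
  forall i j, exists2 t : K, t != 0 & c' i j = t *: c i j.

Section ParameterSpace.
Variables (k : fieldType) (d : nat).

(* Indices of the coefficients: (i, j, l) is the coefficient of x_l in L i j. *)
Notation index := ('I_d.+1 * 'I_d * 'I_d)%type.
Notation cpoly := {mpoly k[#|{: index}|]}.

Definition coef_value (K : fieldType) (c : 'M['rV[K]_d]_(d.+1, d))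
    (v : 'I_#|{: index}|) : K :=
  let: (i, j, l) := enum_val v in c i j 0 l.

(* f is homogeneous separately in the coefficients of each entry. *)
Definition multihomogeneous (f : cpoly) : Prop :=
  forall (i : 'I_d.+1) (j : 'I_d), exists e : nat,
    forall m, m \in msupp f -> (\sum_(l < d) m (enum_rank (i, j, l)) = e)%N.

(* Sets of points of k-schemes are described through their points with values *)
(* in all field extensions iota : k -> K (for K = k, the rational points).    *)
(* Rational points alone would not do: over a finite k their Zariski topology *)
(* is discrete.                                                               *)
Definition pointset : Type :=
  forall K : fieldType, {rmorphism k -> K} -> 'M['rV[K]_d]_(d.+1, d) -> Prop.

(* Unions of non-vanishing loci of polynomials over k from the class H.  For  *)
(* H = multihomogeneous: the Zariski-open subsets of the parameter space; for *)
(* H trivial: those of the space of matrices of nonzero linear forms.         *)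
Definition zariski_open (H : cpoly -> Prop) (U : pointset) : Prop :=
  exists2 S : cpoly -> Prop, forall f, S f -> H f &
    forall (K : fieldType) (iota : {rmorphism k -> K}) c, U K iota c <->
      coordinates c /\
      exists2 f, S f & (map_mpoly iota f).@[coef_value c] != 0.

Definition zariski_dense (H : cpoly -> Prop) (U : pointset) : Prop :=
  forall V : pointset, zariski_open H V ->
    (exists (K : fieldType) (iota : {rmorphism k -> K}) c, V K iota c) ->
    exists (K : fieldType) (iota : {rmorphism k -> K}) c,
      U K iota c /\ V K iota c.

(* A point of the parameter space determines the entries of a matrix only up  *)
(* to independent scalars, which need not preserve P.  So there must be a     *)
(* dense open set W of matrices satisfying P such that the set of parameter   *)
(* points of the matrices in W contains a dense open set U of the parameter   *)
(* space.  The extension tau is there because a K-valued point of a scheme    *)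
(* that lies in an image set need only lift after extending K.                *)
Definition general_linear_matrix
    (P : forall K : fieldType, 'M[{mpoly K[d]}]_(d.+1, d) -> Prop) : Prop :=
  exists U W : pointset,
    [/\ zariski_open multihomogeneous U /\ zariski_dense multihomogeneous U,
        zariski_open (fun=> True) W /\ zariski_dense (fun=> True) W,
        forall (K : fieldType) (iota : {rmorphism k -> K}) c, U K iota c ->
          exists (K' : fieldType) (tau : {rmorphism K -> K'}) c',
            same_point (map_mx (map_mx tau) c) c' /\ W K' (tau \o iota) c'
      & forall (K : fieldType) (iota : {rmorphism k -> K}) c, W K iota c ->
          P K (linear_matrix c)].

End ParameterSpace.

(* Main.v *)
Require Import Defs.
From HB Require Import structures.
From mathcomp Require Import all_boot all_order all_algebra.
From mathcomp Require Import mpoly.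
From mathcomp Require boolp classical_sets.

Set Implicit Arguments.
Unset Strict Implicit.
Unset Printing Implicit Defensive.

Import GRing.Theory.
Local Open Scope ring_scope.

(** Let [x] be the vector of the variables and [Delta] the signed maximal minors
    of the linear matrix [L]. Evaluating [y L = x B] at [y = Delta] gives
    [Psi x = 0], because [Delta L = 0]. Hence the cofactors of the [j]-th row of
    [Psi], which are the values at [Delta] of the [j]-th basic representative
    [g], are proportional to [x]: the cofactor at [(j, i)] is [D_j X_i]
    ([cofactors_variables]). So [D_j] is the inversion factor of [g]. As [L] is
    linear, [Delta] evaluated at [g (Delta) = D_j x] is [D_j ^ d Delta], so a
    representative with nonzero factor inverts the map ([basic_inverse]).

    The adjugate of [Psi] is thus the product of the column [x] and the row [D],
    and the complex is exact by the Buchsbaum-Eisenbud criterion once the ideal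
    of the [D_j] has grade two; here the argument is made explicit with
    adjugates, and it uses three variables ([syzygies_factors]).

    For the grade and for the lower bound of the codimension, restrict to a line
    on which [u] and [v], the first and the last variable, are coordinates. If
    two combinations of the [D_j] are coprime on the line and monic in [v], then
    their resultant is a nonzero element of the ideal that does not involve [v]
    ([factors_regular]); with a monic element it forms a regular sequence
    ([regular_pair]) and forces height two ([height_ge2]).

    The codimension is at most two because the [D_j] vanish where [Delta] does.
    If the minors of the restricted pencil span the binary forms of degree [d],
    then the ideal of [Delta] contains no nonzero polynomial in the remaining
    variables ([minors_ideal_free]): filter by the degree in [u] and [v]. So
    these [d - 2] variables are algebraically independent modulo a prime over
    [Delta] ([minors_prime]). A chain of three strict inclusions of primes below
    it would give [d + 1] algebraically independent polynomials in [d] variables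
    ([independent_height_le]).

    These conditions on [L] are collected in [line_general]. They hold where one
    polynomial in the coefficients of [L], [line_condition], is nonzero, and this
    polynomial is not zero because the conditions hold for a matrix whose
    Jacobian dual is nearly bidiagonal on the line ([bidiagonal_line_general]).
    Scaling the entries of [L] by independent variables turns this into an open
    condition on the parameter space ([nonvanishing_general]). *)

(** * Cofactors and one-dimensional kernels *)

Section Cofactors.
Variables (R : comNzRingType) (n : nat).
Implicit Types (A : 'M[R]_n) (x : 'cV[R]_n).

Lemma cofactor_add_delta A j l i :
  cofactor (A + delta_mx j l) j i = cofactor A j i.
Proof.
congr (_ * \det _); apply/matrixP=> a b; rewrite !mxE.
by rewrite eq_sym (negPf (neq_lift _ _)) /= addr0.
Qed.

Lemma det_add_delta A j l : \det (A + delta_mx j l) = \det A + cofactor A j l.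
Proof.
rewrite (expand_det_row _ j) (expand_det_row A j).
under eq_bigr => i _ do rewrite cofactor_add_delta !mxE eqxx /= mulrDl.
rewrite big_split /=; congr (_ + _); rewrite (bigD1 l) //= eqxx mul1r.
by rewrite big1 ?addr0 // => i /negPf->; rewrite mul0r.
Qed.

(** Perturbing the entry (j, l) by one turns the kernel relation [A x = 0]
    into [A' x = x_l e_j], which can be solved by the adjugate of [A']. *)
Lemma cofactor_kernel A x j l i : \det A = 0 -> A *m x = 0 ->
  x l 0 * cofactor A j i = x i 0 * cofactor A j l.
Proof.
move=> A0 Ax0; pose A' := A + delta_mx j l.
have A'x : A' *m x = delta_mx j 0 *m (x l 0)%:M.
  rewrite mulmxDl Ax0 add0r; apply/matrixP=> a b.
  rewrite ord1 [LHS]mxE [RHS]mxE big_ord1 (bigD1 l) //= big1 => [|c /negPf lc].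
    by rewrite !mxE !eqxx !andbT addr0 mulr1n.
  by rewrite !mxE lc andbF mul0r.
have: \adj A' *m (A' *m x) = (\det A')%:M *m x by rewrite mulmxA mul_adj_mx.
rewrite A'x det_add_delta A0 add0r mul_scalar_mx => /matrixP/(_ i 0).
rewrite mulmxA mul_mx_scalar -colE !mxE cofactor_add_delta => ->.
by rewrite mulrC.
Qed.

End Cofactors.

Lemma det_kernel0 (R : idomainType) n (A : 'M[R]_n) (x : 'cV[R]_n) l :
  A *m x = 0 -> x l 0 != 0 -> \det A = 0.
Proof.
move=> Ax0 xl; have: \adj A *m (A *m x) = (\det A)%:M *m x.
  by rewrite mulmxA mul_adj_mx.
rewrite Ax0 mulmx0 mul_scalar_mx => /matrixP/(_ l 0); rewrite !mxE.
by move/esym/eqP; rewrite mulf_eq0 (negPf xl) orbF => /eqP.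
Qed.

Definition maximal_minor (R : comNzRingType) (n : nat) (L : 'M[R]_(n.+1, n))
    (i : 'I_n.+1) : R := (-1) ^+ i * \det (row' i L).

Lemma maximal_minorE (R : comNzRingType) n (L : 'M[R]_(n.+1, n)) i :
  maximal_minor L i = (-1) ^+ i * \det (row' i L).
Proof. by []. Qed.

Lemma map_maximal_minor (R S : comNzRingType) (f : {rmorphism R -> S}) n
    (L : 'M[R]_(n.+1, n)) i :
  f (maximal_minor L i) = maximal_minor (map_mx f L) i.
Proof.
rewrite /maximal_minor rmorphM rmorph_sign -det_map_mx; congr (_ * \det _).
by apply/matrixP => k l; rewrite !mxE.
Qed.

Lemma maximal_minorZ (R : comNzRingType) n a (L : 'M[R]_(n.+1, n)) i :
  maximal_minor (a *: L) i = a ^+ n * maximal_minor L i.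
Proof.
rewrite /maximal_minor mulrCA -detZ; congr (_ * \det _).
by apply/matrixP => k l; rewrite !mxE.
Qed.

Section MaximalMinors.
Variables (R : comNzRingType) (n : nat) (L : 'M[R]_(n.+1, n)).
Local Notation Delta := (maximal_minor L).

Let aug (c : 'cV[R]_n.+1) : 'M[R]_n.+1 := row_mx c L.

Let aug0 c i : aug c i 0 = c i 0.
Proof. by rewrite mxE; case: splitP => // k _; rewrite (ord1 k). Qed.

Let augS c i j : aug c i (lift 0 j) = L i j.
Proof. by rewrite mxE; case: splitP => [[[]]//|k /= [/val_inj->]]. Qed.

Let cofactor_aug c i : cofactor (aug c) i 0 = Delta i.
Proof.
rewrite /cofactor addn0; congr (_ * \det _); apply/matrixP=> a b.
by rewrite mxE [LHS]mxE augS mxE.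
Qed.

Let det_aug c : \det (aug c) = \sum_i c i 0 * Delta i.
Proof.
rewrite (expand_det_col _ 0); apply: eq_bigr => i _; rewrite cofactor_aug.
by rewrite aug0.
Qed.

Let det_aug_delta i : \det (aug (delta_mx i 0)) = Delta i.
Proof.
rewrite det_aug (bigD1 i) //= big1 ?mxE ?eqxx ?mul1r ?addr0 //.
by move=> k /negPf ki; rewrite mxE ki mul0r.
Qed.

(** Expand a determinant that has the column [j] of [L] twice. *)
Lemma minors_syzygy j : \sum_i Delta i * L i j = 0.
Proof.
under eq_bigr => i _ do rewrite mulrC.
have dj : \det (aug (col j L)) = 0.
  rewrite -det_tr; apply: (@determinant_alternate _ _ _ 0 (lift 0 j)) => // k.
  by rewrite mxE [RHS]mxE aug0 augS mxE.
by rewrite -[RHS]dj det_aug; apply: eq_bigr => i _; rewrite mxE.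
Qed.

(** Up to sign, the maximal minors are the cofactors of a column added to [L].
    If that column is the [i]-th unit vector, [a] times the enlarged matrix has
    the single entry [a i]; multiply by the adjugate. *)
Lemma kernel_minors (a : 'rV[R]_n.+1) i j :
  a *m L = 0 -> Delta i * a 0 j = Delta j * a 0 i.
Proof.
move=> aL0; pose M := aug (delta_mx i 0).
have aM k : (a *m M) 0 k = a 0 i *+ (k == 0).
  case: (unliftP 0 k) => [l|] ->.
    rewrite eq_sym (negPf (neq_lift _ _)) mulr0n.
    have := congr1 (fun u : 'rV__ => u 0 l) aL0; rewrite !mxE => aL0l.
    by rewrite -[RHS]aL0l; apply: eq_bigr => m _; rewrite augS.
  rewrite mxE (bigD1 i) //= aug0 mxE !eqxx mulr1 big1 ?addr0 // => m /negPf mi.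
  by rewrite aug0 mxE mi mulr0.
have: a *m M *m \adj M = a *m (\det M)%:M by rewrite -mulmxA mul_mx_adj.
rewrite det_aug_delta mul_mx_scalar => /matrixP/(_ 0 j).
rewrite [RHS]mxE => <-; rewrite mxE (bigD1 0) //= big1 => [|k /negPf k0].
  by rewrite addr0 aM mulrC mxE cofactor_aug.
by rewrite aM k0 mul0r.
Qed.

(** Multiplying the adjugate of the same enlarged matrix by it shows that the
    maximal minors annihilate the cokernel of the transpose of [L]. *)
Lemma minor_in_row_image i (v : 'rV[R]_n) :
  exists a : 'rV[R]_n.+1, a *m L = Delta i *: v.
Proof.
pose M := aug (delta_mx i 0).
pose b : 'rV[R]_n.+1 := \row_k (if unlift 0 k is Some l then v 0 l else 0).
exists (b *m \adj M).
have: b *m \adj M *m M = b *m (\det M)%:M by rewrite -mulmxA mul_adj_mx.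
rewrite det_aug_delta mul_mx_scalar => /matrixP bM; apply/matrixP => o j.
have := bM o (lift 0 j); rewrite [RHS]mxE [in RHS]mxE liftK ord1 => bMj.
rewrite !mxE -[RHS]bMj mxE; apply: eq_bigr => k _.
by rewrite augS.
Qed.

End MaximalMinors.

(* From here on the minors are used through the lemmas above only. *)
#[global] Opaque maximal_minor.

(** * Polynomials and their variables *)

Lemma mpoly_rmorphism_ext (R : comNzRingType) (S : nzRingType) n
    (f g : {rmorphism {mpoly R[n]} -> S}) :
  (forall c, f c%:MP = g c%:MP) -> (forall i, f 'X_i = g 'X_i) -> f =1 g.
Proof.
move=> fgC fgX p; rewrite [p]mpolyE !rmorph_sum /=; apply: eq_bigr => m _.
rewrite -mul_mpolyC !rmorphM /= fgC; congr (_ * _).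
rewrite mpolyXE_id !rmorph_prod /=; apply: eq_bigr => i _.
by rewrite !rmorphXn /= fgX.
Qed.

Section Variables.
Variables (R : idomainType) (n : nat).
Implicit Types (a b : {mpoly R[n]}).

Lemma mpoly_dvdX a j q : (forall m, m \in msupp a -> (q <= m j)%N) ->
  exists c, a = 'X_j ^+ q * c.
Proof.
move=> hm; exists (\sum_(m <- msupp a) a@_m *: 'X_[m - U_(j) *+ q]).
rewrite {1}[a]mpolyE mulr_sumr !big_seq; apply: eq_bigr => m ma.
rewrite -scalerAr mpolyXn -mpolyXD; congr (_ *: 'X_[_]).
rewrite addmC submK //; apply/mnm_lepP => i; rewrite mulmnE mnm1E.
by case: eqP => [<-|_]; rewrite ?mul1n ?hm.
Qed.

Lemma msupp_mulX b j q m : m \in msupp ('X_j ^+ q * b) -> (q <= m j)%N.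
Proof.
rewrite mpolyXn mulrC (perm_mem (msuppMX _ _)) => /mapP[m' _ ->].
by rewrite mnmDE mulmnE mnm1E eqxx mul1n leq_addr.
Qed.

Lemma variables_regular a b i j p q : i != j ->
  'X_i ^+ p * a = 'X_j ^+ q * b -> exists c, a = 'X_j ^+ q * c.
Proof.
move=> ij ab; apply: mpoly_dvdX => m ma.
have: (U_(i) *+ p + m)%MM \in msupp ('X_j ^+ q * b).
  rewrite -ab mpolyXn mulrC (perm_mem (msuppMX _ _)).
  by apply/mapP; exists m.
by move/msupp_mulX; rewrite mnmDE mulmnE mnm1E (negPf ij) mul0n add0n.
Qed.

Lemma mpolyX_neq0 (m : 'X_{1..n}) : 'X_[m] != 0 :> {mpoly R[n]}.
Proof. by rewrite -msize_poly_eq0 msizeX. Qed.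

End Variables.

(** The restriction of a polynomial to the affine line on which the variable
    [u] is 1, [v] is the coordinate, and the others vanish. *)
Section LineRestriction.
Variables (R : comNzRingType) (n : nat) (u v : 'I_n).

Definition line_value (i : 'I_n) : {poly R} :=
  if i == u then 1 else if i == v then 'X else 0.

Definition line_restriction (p : {mpoly R[n]}) : {poly R} :=
  mmap polyC line_value p.

HB.instance Definition _ := GRing.RMorphism.copy line_restriction (mmap polyC
  line_value).

Lemma line_restrictionX i : line_restriction 'X_i = line_value i.
Proof. by rewrite /line_restriction mmapX mmap1U. Qed.

Lemma line_restrictionC c : line_restriction c%:MP = c%:P.
Proof. by rewrite /line_restriction mmapC. Qed.

Lemma line_restrictionZ c p : line_restriction (c *: p) = c *: line_restriction
  p.
Proof.
by rewrite -mul_mpolyC rmorphM /= line_restrictionC mul_polyC.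
Qed.

Hypothesis uv : u != v.

(** A form is not changed by setting [u] to 1, since its degree recovers the
    exponents of [u]; so only the monomials in [u] and [v] matter. *)
Lemma coef_line_restriction p d j : p \is d.-homog ->
  (line_restriction p)`_j
    = if (j <= d)%N then p@_(U_(u) *+ (d - j) + U_(v) *+ j) else 0.
Proof.
move=> /dhomogP hp; rewrite {1}[p]mpolyE rmorph_sum /= coef_sum.
have mon m : m \in msupp p ->
    (line_restriction 'X_[m])`_j
      = ((j <= d)%N && (m == U_(u) *+ (d - j) + U_(v) *+ j)%MM)%:R.
  move=> /hp dm; rewrite /line_restriction mmapX /mmap1.
  case: (boolP [exists i, [&& i != u, i != v & m i != 0%N]]) => [|none].
    case/existsP=> i /and3P[iu iv mi]; rewrite (bigD1 i) //= /line_value.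
    rewrite (negPf iu) (negPf iv) expr0n (negPf mi) mul0r coef0.
    case: eqP => [mE|]; last by rewrite andbF.
    case/eqP: mi; rewrite mE mnmDE !mulmnE !mnm1E.
    by rewrite ![_ == i]eq_sym (negPf iu) (negPf iv) !mul0n.
  have m0 i : i != u -> i != v -> m i = 0%N.
    move=> iu iv; apply: contraNeq none => mi.
    by apply/existsP; exists i; rewrite iu iv.
  have dE : d = (m u + m v)%N.
    transitivity (mdeg m); first by rewrite -dm.
    rewrite mdegE (bigD1 u) //= (bigD1 v) 1?eq_sym //= big1 ?addn0 //.
    by move=> i /andP[iu iv]; apply: m0.
  rewrite (bigD1 u) //= (bigD1 v) 1?eq_sym //= big1 => [|i /andP[iu iv]]; last
    first.
    by rewrite m0 ?expr0.
  rewrite /line_value eqxx expr1n mul1r [v == u]eq_sym (negPf uv) eqxx mulr1.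
  rewrite coefXn; congr (_ %:R); congr nat_of_bool.
  apply/eqP/andP=> [->|[jd /eqP mE]]; last first.
    by rewrite -mE mnmDE !mulmnE !mnm1E (negPf uv) eqxx mul1n.
    split; first by rewrite dE leq_addl.
    apply/eqP/mnmP => i; rewrite mnmDE !mulmnE !mnm1E dE addnK.
    have [->|iu] := eqVneq i u.
      by rewrite [v == u]eq_sym (negPf uv) mul1n mul0n addn0.
    have [->|iv] := eqVneq v i; first by rewrite mul0n mul1n.
    by rewrite !mul0n m0 // eq_sym.
under eq_big_seq => m mp do rewrite line_restrictionZ coefZ mon //.
case: leqP => [jd|_]; last by rewrite big1 // => m _; rewrite mulr0.
rewrite [in RHS](mpolyE p) raddf_sum /=.
by apply: eq_bigr => m _; rewrite mcoeffZ mcoeffX.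
Qed.

End LineRestriction.

(** ** The last variable *)
Section LastVariable.
Variables (R : comNzRingType) (n : nat).
Local Notation widen := (widen_ord (leqnSn n)).

Definition ofuni (p : {poly {mpoly R[n]}}) : {mpoly R[n.+1]} :=
  (map_poly (@mwiden n R) p).['X_ord_max].

Lemma ofuni_is_zmod_morphism : zmod_morphism ofuni.
Proof. by move=> p q; rewrite /ofuni rmorphB hornerD hornerN. Qed.
Lemma ofuni_is_monoid_morphism : monoid_morphism ofuni.
Proof. by split=> [|p q]; rewrite /ofuni ?rmorph1 ?hornerC // rmorphM hornerM.
  Qed.
HB.instance Definition _ := GRing.isZmodMorphism.Build _ _ ofuni
  ofuni_is_zmod_morphism.
HB.instance Definition _ := GRing.isMonoidMorphism.Build _ _ ofuni
  ofuni_is_monoid_morphism.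

Lemma muniX_max : muni ('X_ord_max : {mpoly R[n.+1]}) = 'X.
Proof.
rewrite muniE msuppX big_seq1 mcoeffX eqxx scale1r mnm1E eqxx expr1.
rewrite (_ : [multinom _ | i < n] = 0%MM) ?mpolyX0 ?scale1r //.
apply/mnmP => i; rewrite mnmE mnm1E mnm0E; case: eqP => // /(congr1 val) /= e.
by have := ltn_ord i; rewrite -e ltnn.
Qed.

Lemma muniX_widen i : muni ('X_(widen i) : {mpoly R[n.+1]}) = ('X_i)%:P.
Proof.
rewrite muniE msuppX big_seq1 mcoeffX eqxx scale1r mnm1E.
rewrite (_ : (widen i == ord_max) = false) ?expr0 ?alg_polyC; last first.
  by apply/eqP=> /(congr1 val) /= e; have := ltn_ord i; rewrite e ltnn.
congr (_%:P); congr 'X_[_]; apply/mnmP => j; rewrite mnmE !mnm1E.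
by rewrite (inj_eq (f := widen)) // => a b /(congr1 val) /= /val_inj.
Qed.

Lemma ord_max_or_widen (i : 'I_n.+1) : i = ord_max \/ exists j, i = widen j.
Proof.
case: (unliftP ord_max i) => [j ->|->]; [right|by left].
by exists j; apply/val_inj; rewrite /= /bump leqNgt ltn_ord.
Qed.

Lemma muniK : cancel (@muni n R) ofuni.
Proof.
apply: (mpoly_rmorphism_ext (f := ofuni \o @muni n R) (g := idfun)) => [c|i] /=.
  by rewrite muniC /ofuni map_polyC hornerC /= mwidenC.
case: (ord_max_or_widen i) => [->|[j ->]].
  by rewrite muniX_max /ofuni map_polyX hornerX.
by rewrite muniX_widen /ofuni map_polyC hornerC /= mwidenX mnmwiden1.
Qed.

Lemma ofuniK : cancel ofuni (@muni n R).
Proof.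
move=> p; rewrite /ofuni horner_coef rmorph_sum /= size_map_inj_poly //; first
  last.
- exact: mwiden0.
- exact: inj_mwiden.
rewrite -[RHS]coefK poly_def; apply: eq_bigr => i _.
rewrite rmorphM rmorphXn /= muniX_max coef_map /= -mul_polyC; congr (_ * _).
elim/mpolyind: p`_i => [|c m q _ _ IH]; first by rewrite mwiden0 muni0.
rewrite mwidenD muniD IH polyCD; congr (_ + _).
rewrite mwidenZ mwidenX muniZ -mul_mpolyC polyCM -mul_polyC; congr (_ * _).
rewrite mpolyXE_id big_ord_recr /= mnmwiden_ordmax expr0 mulr1 rmorph_prod.
rewrite mpolyXE_id rmorph_prod; apply: eq_bigr => k _.
by rewrite !rmorphXn /= muniX_widen mnmwiden_widen.
Qed.

Lemma muni_mwiden (a : {mpoly R[n]}) : muni (mwiden a) = a%:P.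
Proof.
by apply: (can_inj ofuniK); rewrite muniK /ofuni map_polyC hornerC.
Qed.

End LastVariable.

(** * Prime ideals and heights *)

Section Ideals.
Variable A : comNzRingType.
Implicit Types (P : {pred A}).

Lemma ideal0 P : idealr_closed P -> 0 \in P.
Proof. by case. Qed.

Lemma idealD P a b : idealr_closed P -> a \in P -> b \in P -> a + b \in P.
Proof. by case=> _ _ iP Pa Pb; rewrite -[a]mul1r iP. Qed.

Lemma idealMl P r a : idealr_closed P -> a \in P -> r * a \in P.
Proof. by case=> P0 _ iP Pa; rewrite -[_ * _]addr0 iP. Qed.

Lemma ideal_sum P (I : Type) (r : seq I) (p : pred I) (F : I -> A) :
  idealr_closed P -> (forall i, p i -> F i \in P) -> \sum_(i <- r | p i) F i \in
    P.
Proof.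
move=> iP FP; elim/big_rec: _ => [|i x pi Px]; first exact: ideal0.
exact: idealD (FP i pi) Px.
Qed.

Lemma idealDr P a b : idealr_closed P -> a \in P -> a + b \in P -> b \in P.
Proof.
move=> iP Pa Pab; rewrite -(addKr a b) -mulN1r.
exact: idealD (idealMl _ iP Pa) Pab.
Qed.

Lemma zero_prime_ideal (B : idomainType) : prime_ideal (pred1 (0 : B)).
Proof.
split; last by move=> u v; rewrite !inE mulf_eq0.
split=> [||a u v]; rewrite !inE ?eqxx ?oner_eq0 //.
by move=> /eqP-> /eqP->; rewrite mulr0 addr0.
Qed.

Lemma preimage_prime_ideal (B : comNzRingType) (f : {rmorphism A -> B})
    (P : {pred B}) : prime_ideal P -> prime_ideal [pred a | f a \in P].
Proof.
case=> [[P0 P1 iP] pP]; split; last first.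
  by move=> u v; rewrite !inE rmorphM => /pP.
split=> [||a u v]; rewrite !inE ?rmorph0 ?rmorph1 //.
by move=> Pu Pv; rewrite rmorphD rmorphM iP.
Qed.

Lemma all_coefP P (f : {poly A}) : 0 \in P ->
  reflect (forall i, f`_i \in P) (all (fun c => c \in P) f).
Proof.
move=> P0; apply: (iffP (all_nthP 0)) => [Pf i|Pf i _]; last exact: Pf.
by case: (ltnP i (size f)) => [/Pf//|/leq_sizeP/(_ i (leqnn i))->].
Qed.

Definition coef_ideal P : {pred {poly A}} :=
  [pred f : {poly A} | all (fun c => c \in P) f].

(** In a product, look at the coefficient in the sum of the two least degrees
    where the factors have a coefficient outside [P]. *)
Lemma coef_ideal_prime P : prime_ideal P -> prime_ideal (coef_ideal P).
Proof.
move=> [iP pP]; have P0 := ideal0 iP; split.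
  split=> [||a u v].
  - by apply/all_coefP => // i; rewrite coef0.
  - apply/negP=> /all_coefP-/(_ P0 0%N); rewrite coef1 /=.
    by case: iP => _ /negP.
  - move=> /all_coefP-/(_ P0) Pu /all_coefP-/(_ P0) Pv.
    apply/all_coefP => // i; rewrite coefD coefM; apply: idealD => //.
    by apply: ideal_sum => // j _; apply: idealMl.
have least (u : {poly A}) : u \notin coef_ideal P ->
    exists i, u`_i \notin P /\ forall j, (j < i)%N -> u`_j \in P.
  move=> /allPn[c /(nthP 0)[i _ <-] Pui].
  have ex : exists i, u`_i \notin P by exists i.
  exists (ex_minn ex); case: ex_minnP => m Pm min; split=> // j jm.
  by apply: contraTT jm => Pj; rewrite -leqNgt min.
move=> u v Puv; apply/orP; case: (boolP (u \in _)) => [|Pu]; [by left|right].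
apply: contraT => Pv; have [i [ui iu]] := least _ Pu; have [j [vj jv]] := least
  _ Pv.
have: (u * v)`_(i + j) \in P by apply/all_coefP.
have ij : (i < (i + j).+1)%N by rewrite ltnS leq_addr.
rewrite coefM (bigD1 (Ordinal ij)) //= addKn addrC => Psum.
have rest : \sum_(k < (i + j).+1 | k != Ordinal ij) u`_k * v`_(i + j - k) \in P.
  apply: ideal_sum => // k; rewrite -val_eqE /= neq_ltn => /orP[ki|ik].
    by rewrite mulrC; apply: idealMl (iu _ ki).
  apply: idealMl => //; apply: jv.
  by rewrite ltn_subLR ?ltn_add2r // -ltnS ltn_ord.
have := idealDr iP rest Psum.
by move=> /pP/orP[]; [rewrite (negPf ui)|rewrite (negPf vj)].
Qed.

End Ideals.

Lemma muni_prime_ideal (R : comNzRingType) n (p : {pred {mpoly R[n]}}) :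
  prime_ideal p ->
  prime_ideal [pred f : {mpoly R[n.+1]} | all (fun c => c \in p) (muni f)].
Proof.
move=> pp; have [[p0 p1 ip] cp] := coef_ideal_prime pp; split; last first.
  by move=> u v; rewrite !inE (@muniM n R) => /cp.
split; rewrite ?inE ?muni0 ?muni1 //.
by move=> a u v; rewrite !inE muniD muniM; apply: ip.
Qed.

(** The polynomials all of whose coefficients in the last variable lie in [P]
    form a prime ideal inside [P]. It is nonzero because of [c], and it does not
    contain [g], whose leading coefficient is a unit. *)
Lemma height_ge2 (R : idomainType) n (P : {pred {mpoly R[n.+1]}})
    (c : {mpoly R[n]}) (g : {mpoly R[n.+1]}) :
  prime_ideal P -> c != 0 -> mwiden c \in P ->
  g \in P -> lead_coef (muni g) \is a GRing.unit -> height_ge P 2.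
Proof.
move=> Pprime c0 cP gP gunit.
pose p0 := [pred a : {mpoly R[n]} | mwiden a \in P].
have p0prime : prime_ideal p0 by apply: (preimage_prime_ideal _ Pprime).
have p00 : 0 \in p0 by case: p0prime => [[]].
pose Q := [pred f : {mpoly R[n.+1]} | all (fun c => c \in p0) (muni f)].
have Qprime : prime_ideal Q.
  exact: muni_prime_ideal.
pose chain (i : nat) : {pred {mpoly R[n.+1]}} :=
  match i with 0%N => pred1 0 | 1%N => Q | _ => P end.
exists chain.
split=> // [[|[|i]] _|[|[|i]] //= _].
- exact: zero_prime_ideal.
- exact: Qprime.
- exact: Pprime.
- split=> [f|QQ0].
    by rewrite inE => /eqP->; apply: (ideal0 Qprime.1).
  have c0' : mwiden c != 0 by rewrite -(mwiden0 n R) (inj_eq (@inj_mwiden n R)).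
  move/negP: c0'; apply.
  apply: (QQ0 (mwiden c)).
  rewrite inE /=.
  by rewrite muni_mwiden polyseqC c0 /= andbT inE.
- split=> [f|PQ].
    rewrite inE /= => /all_coefP-/(_ p00) Pf.
    rewrite -[f]muniK /ofuni horner_coef; apply: (ideal_sum _ Pprime.1) => i _.
    by rewrite coef_map mulrC; apply: (idealMl _ Pprime.1); apply: Pf.
  have := PQ g gP; rewrite inE /= => /all_coefP-/(_ p00) pg.
  have := pg (size (muni g)).-1; rewrite -lead_coefE => pl.
  case: p0prime => [ip0 _]; have := idealMl (lead_coef (muni g))^-1 ip0 pl.
  by rewrite mulVr //; case: ip0 => _ /negP.
Qed.

(** ** Algebraic independence modulo a prime ideal *)

Section Independence.
Variables (K : fieldType) (n : nat).
Local Notation R := {mpoly K[n]}.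

Definition subst t (f : 'I_t -> R) (F : {mpoly K[t]}) : R :=
  mmap (@mpolyC n K) f F.

HB.instance Definition _ t (f : 'I_t -> R) :=
  GRing.RMorphism.copy (subst f) (mmap (@mpolyC n K) f).

Lemma substC t (f : 'I_t -> R) c : subst f c%:MP = c%:MP.
Proof. by rewrite /subst mmapC. Qed.

Lemma substX t (f : 'I_t -> R) i : subst f 'X_i = f i.
Proof. by rewrite /subst mmapX mmap1U. Qed.

Definition independent_mod (I : R -> Prop) t (f : 'I_t -> R) :=
  forall F, I (subst f F) -> F = 0.

Definition add_last t (f : 'I_t -> R) (g : R) (i : 'I_t.+1) : R :=
  if unlift ord_max i is Some j then f j else g.

Lemma subst_add_last t (f : 'I_t -> R) g F :
  subst (add_last f g) F = (map_poly (subst f) (muni F)).[g].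
Proof.
pose h := horner_eval g \o (map_poly (subst f) \o @muni t K).
apply: (mpoly_rmorphism_ext (f := subst (add_last f g)) (g := h)) => [c|i].
  by rewrite [LHS]substC /h /= muniC map_polyC /horner_eval hornerC /= substC.
rewrite [LHS]substX /h /= /horner_eval /add_last.
case: (ord_max_or_widen i) => [->|[j ->]].
  by rewrite unlift_none muniX_max map_polyX hornerX.
rewrite muniX_widen map_polyC hornerC /= substX.
have -> : widen_ord (leqnSn t) j = lift ord_max j.
  by apply/val_inj; rewrite /= /bump leqNgt ltn_ord.
by rewrite liftK.
Qed.

(** Let a polynomial in [f] and [g] lie in [P]. Modulo [Q], where [g] vanishes,
    its constant term in [g] is a relation between the [f], hence zero; so [g],
    which is not in [P], can be cancelled. *)
Lemma independent_add_last (P Q : {pred R}) t (f : 'I_t -> R) g :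
  prime_ideal P -> prime_ideal Q -> {subset P <= Q} ->
  g \in Q -> g \notin P -> independent_mod (fun a => a \in Q) f ->
  independent_mod (fun a => a \in P) (add_last f g).
Proof.
move=> [iP pP] [iQ _] PQ gQ gP fQ F; rewrite subst_add_last => PF.
apply: (can_inj (@muniK K t)); rewrite muni0.
elim/poly_ind: (muni F) PF => // p c IH.
rewrite rmorphD rmorphM /= map_polyX map_polyC hornerD hornerMX hornerC => Ppc.
have c0 : c = 0.
  apply: fQ; apply: (idealDr iQ _ (PQ _ Ppc)).
  exact: idealMl.
move: Ppc; rewrite c0 /= rmorph0 addr0 addr0 => /pP.
by rewrite (negPf gP) orbF => /IH ->; rewrite mul0r.
Qed.

End Independence.

Section TranscendenceDegree.
Variables (K : fieldType) (n : nat).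
Local Notation R := {mpoly K[n]}.

(** The vanishing of the combination is a linear system for its coefficients with
    more unknowns than equations. *)
Lemma many_polys_dependent (I : finType) (p : I -> R) b :
  (forall i m j, m \in msupp (p i) -> (m j <= b)%N) ->
  (b.+1 ^ n < #|I|)%N ->
  exists2 c : I -> K, (exists i, c i != 0) & \sum_i c i *: p i = 0.
Proof.
move=> pb card; pose T := {ffun 'I_n -> 'I_b.+1}.
pose M := \matrix_(i < #|I|, j < #|T|)
  (p (enum_val i))@_[multinom (enum_val j k : nat) | k < n].
have : kermx M != 0.
  rewrite kermx_eq0 /row_free neq_ltn (leq_ltn_trans (rank_leq_col M)) //.
  by rewrite card_ffun !card_ord.
case/rowV0Pn=> w /sub_kermxP wM w0; exists (fun i => w 0 (enum_rank i)).
  have [i wi] : exists i, w 0 i != 0 by apply/rV0Pn.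
  by exists (enum_val i); rewrite enum_valK.
apply/mpolyP => m; rewrite mcoeff0 raddf_sum /=.
case: (boolP [forall k, m k <= b]%N) => [/forallP mb|/forallPn[k mk]]; last
  first.
  rewrite big1 // => i _; rewrite mcoeffZ (memN_msupp_eq0 (p := p i)) ?mulr0 //.
  by apply: contra mk => /pb.
pose t : T := [ffun k => inord (m k)].
have mE : m = [multinom (t k : nat) | k < n].
  by apply/mnmP => k; rewrite mnmE ffunE inordK // ltnS mb.
have /matrixP/(_ 0 (enum_rank t)) := wM; rewrite !mxE => wMt.
rewrite -[RHS]wMt (reindex_onto (@enum_rank I) (@enum_val I predT)) /=; last
  first.
  by move=> i _; rewrite enum_valK.
apply: eq_big => [i|i _]; first by rewrite enum_rankK eqxx.
by rewrite mcoeffZ mxE !enum_rankK -mE.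
Qed.

Lemma msupp_degree_prod t (f : 'I_t -> R) e (a : 'I_t -> nat) M m :
  (forall i, msize (f i) <= e.+1)%N -> (forall i, a i <= M)%N ->
  m \in msupp (\prod_i f i ^+ a i) -> (mdeg m <= t * (M * e))%N.
Proof.
move=> fe aM; move: m; suff H (r : seq 'I_t) m :
    m \in msupp (\prod_(i <- r) f i ^+ a i) -> (mdeg m <= size r * (M * e))%N.
  move=> m /H; rewrite /index_enum -enumT -cardE card_ord //.
have Hpow i k m' : m' \in msupp (f i ^+ k) -> (mdeg m' <= k * e)%N.
  elim: k m' => [|k IH] m'; first by rewrite expr0 msupp1 inE => /eqP->; rewrite
    mdeg0.
  rewrite exprS => /msuppM_le/allpairsP[[m1 m2] /= [m1P m2P ->]].
  rewrite mdegD mulSn leq_add ?IH //.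
  by rewrite -ltnS (leq_trans (msize_mdeg_lt m1P)).
elim: r m => [|i r IH] m; first by rewrite big_nil msupp1 inE => /eqP->; rewrite
  mdeg0.
rewrite big_cons => /msuppM_le/allpairsP[[m1 m2] /= [m1P m2P ->]].
rewrite mdegD mulSn leq_add ?IH //.
by rewrite (leq_trans (Hpow _ _ _ m1P)) // leq_mul2r aM orbT.
Qed.

(** There are [M.+1 ^ t] monomials of exponents at most [M] in [t]
    variables; after substitution they lie in a space whose dimension is at
    most [(c * M.+1) ^ n] for a constant [c], and [c ^ n < M.+1] for large [M].
      *)
Lemma algebraically_dependent t (f : 'I_t -> R) : (n < t)%N ->
  exists2 F : {mpoly K[t]}, F != 0 & subst f F = 0.
Proof.
move=> nt; pose e := (\max_i msize (f i))%N.
have fe i : (msize (f i) <= e.+1)%N.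
  by apply: leqW; rewrite /e (bigD1 i) //= leq_maxl.
pose c := (t * e).+1; pose M := (c ^ n)%N; pose b := (t * (M * e))%N.
pose I := {ffun 'I_t -> 'I_M.+1}.
pose p (a : I) : R := \prod_i f i ^+ a i.
have pb a m j : m \in msupp (p a) -> (m j <= b)%N.
  move=> /(msupp_degree_prod fe (M := M)) mb; apply: leq_trans (mb _); last
    first.
    by move=> i; rewrite -ltnS ltn_ord.
  by rewrite mdegE (bigD1 j) //= leq_addr.
have card : (b.+1 ^ n < #|I|)%N.
  have bM : (b.+1 <= c * M.+1)%N.
    by rewrite /b /c mulnCA [(M * _)%N]mulnC mulSn mulnS addSn ltnS addnA
      leq_addl.
  rewrite card_ffun !card_ord; apply: (@leq_ltn_trans ((c * M.+1) ^ n)).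
    by case: (n) => // n'; rewrite leq_exp2r.
  apply: (@leq_trans (M.+1 ^ n.+1)); last by rewrite leq_pexp2l.
  by rewrite expnMn expnS ltn_mul2r expn_gt0 /= ltnSn.
have [w [a wa] w0] := many_polys_dependent pb card.
pose mon (a : I) : 'X_{1..t} := [multinom (a i : nat) | i < t].
have mon_inj : injective mon.
  move=> a1 a2 /mnmP a12; apply/ffunP => i; apply/val_inj.
  by have := a12 i; rewrite !mnmE.
exists (\sum_a w a *: 'X_[mon a]).
  apply: contraNneq wa => /(congr1 (mcoeff (mon a))).
  rewrite mcoeff0 raddf_sum (bigD1 a) //= mcoeffZ mcoeffX eqxx mulr1 big1
    ?addr0.
    by move=> ->.
  by move=> a' /negPf a'a; rewrite mcoeffZ mcoeffX (inj_eq mon_inj) a'a mulr0.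
rewrite rmorph_sum -[RHS]w0; apply: eq_bigr => a' _ /=.
rewrite -mul_mpolyC rmorphM /= substC mul_mpolyC; congr (_ *: _).
rewrite /subst mmapX /mmap1; apply: eq_bigr => i _.
by rewrite mnmE.
Qed.

(** Along a chain of primes each strict inclusion costs one independent
    element, by [independent_add_last]. *)
Lemma independent_height_le (P : {pred R}) t (f : 'I_t -> R) m :
  independent_mod (fun a => a \in P) f -> height_ge P m -> (t + m <= n)%N.
Proof.
move=> fP [Q [Qprime Qlt QP]].
have step i : (i <= m)%N ->
    exists g : 'I_(t + i) -> R, independent_mod (fun a => a \in Q (m - i)%N) g.
  elim: i => [_|i IH im].
    by rewrite addn0 subn0; exists f => F; rewrite QP; apply: fP.
  have [g gQ] := IH (ltnW im); rewrite addnS.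
  have mi : ((m - i.+1).+1 = m - i)%N by rewrite subnSK.
  have lt : (m - i.+1 < m)%N by rewrite mi leq_subr.
  have [sub nsub] := Qlt _ lt.
  have [h hQ hnQ] : exists2 h, h \in Q (m - i)%N & h \notin Q (m - i.+1)%N.
    apply: boolp.contrapT => none; apply: nsub => h; rewrite mi => hQ.
    by apply: contraT => hnQ; case: none; exists h.
  exists (add_last g h); apply: (independent_add_last (Q := Q (m - i)%N)) => //.
  - exact/Qprime/leq_subr.
  - exact/Qprime/leq_subr.
  - by rewrite -mi.
have [g gQ] := step m (leqnn m); rewrite leqNgt; apply/negP => lt.
have [F F0 gF] := algebraically_dependent g lt.
have [[Q0 _ _] _] := Qprime 0%N isT.
by move/eqP: F0; apply; apply: gQ; rewrite gF subnn.
Qed.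

End TranscendenceDegree.

(** ** Existence of primes *)

Section PrimeAvoidance.
Variable A : comNzRingType.
Variables (I S : A -> Prop).
Hypotheses (I0 : I 0) (ID : forall a b, I a -> I b -> I (a + b))
  (IM : forall r a, I a -> I (r * a)).
Hypotheses (S1 : S 1) (SM : forall a b, S a -> S b -> S (a * b)).
Hypothesis IS : forall a, I a -> ~ S a.

(** Generation by finitely many steps is inherited by the union of a chain,
    as the chain condition of Zorn's lemma requires. *)
Inductive ideal_span (X : A -> Prop) : A -> Prop :=
| span_base a : I a -> ideal_span X a
| span_gen a : X a -> ideal_span X a
| span_add a b : ideal_span X a -> ideal_span X b -> ideal_span X (a + b)
| span_mul r a : ideal_span X a -> ideal_span X (r * a).

Lemma ideal_span_sub (X Y : A -> Prop) a :
  (forall b, X b -> ideal_span Y b) -> ideal_span X a -> ideal_span Y a.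
Proof.
move=> XY; elim=> [b Ib|b Xb|b c _ Yb _ Yc|r b _ Yb].
- exact: span_base.
- exact: XY.
- exact: span_add.
- exact: span_mul.
Qed.

Lemma ideal_span_add1 (X : A -> Prop) u a :
  ideal_span (fun b => X b \/ b = u) a ->
  exists b r, ideal_span X b /\ a = b + r * u.
Proof.
elim=> [b Ib|b [Xb| ->]|b c _ [b' [r [Xb ->]]] _ [c' [s [Xc ->]]]|r b _ [b' [s
  [Xb ->]]]].
- by exists b, 0; rewrite mul0r addr0; split=> //; apply: span_base.
- by exists b, 0; rewrite mul0r addr0; split=> //; apply: span_gen.
- by exists 0, 1; rewrite mul1r add0r; split=> //; apply: span_base.
- exists (b' + c'), (r + s); split; first exact: span_add.
  by rewrite mulrDl addrACA.
- exists (r * b'), (r * s); split; first exact: span_mul.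
  by rewrite mulrDr mulrA.
Qed.

(** Among the ideals containing [I] and missing the multiplicative set [S], a
    maximal one is prime. *)
Lemma prime_avoiding : exists P : {pred A},
  [/\ prime_ideal P, forall a, I a -> a \in P & forall a, a \in P -> ~ S a].
Proof.
pose good (X : classical_sets.set A) := forall a, ideal_span X a -> ~ S a.
have [X [goodX maxX]] : exists X, good X /\
    forall Y, classical_sets.proper X Y -> ~ good Y.
  apply: classical_sets.Zorn_bigcup => F Fgood Ftot a aF.
  suff : I a \/ exists X, F X /\ ideal_span X a.
    by case=> [|[X [/Fgood gX /gX]]]; first exact: IS.
  elim: aF => {a} [a Ia|a [X FX Xa]|a b _ IHa _ IHb|r a _ IHa].
  - by left.
  - by right; exists X; split=> //; apply: span_gen.
  - case: IHa => [Ia|[X [FX Xa]]]; case: IHb => [Ib|[Y [FY Yb]]].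
    + by left; apply: ID.
    + by right; exists Y; split=> //; apply: span_add => //; apply: span_base.
    + by right; exists X; split=> //; apply: span_add => //; apply: span_base.
    + case: (Ftot X Y FX FY) => sub; right.
        exists Y; split=> //; apply: span_add => //.
        by apply: ideal_span_sub Xa => c Xc; apply/span_gen/sub.
      exists X; split=> //; apply: span_add => //.
      by apply: ideal_span_sub Yb => c Yc; apply/span_gen/sub.
  - case: IHa => [Ia|[X [FX Xa]]]; first by left; apply: IM.
    by right; exists X; split=> //; apply: span_mul.
pose P : {pred A} := fun a => boolp.asbool (ideal_span X a).
have PE a : a \in P <-> ideal_span X a by rewrite unfold_in; split=>
  /boolp.asboolP.
have meet u : u \notin P -> exists b r, ideal_span X b /\ S (b + r * u).
  move=> uP; apply: boolp.contrapT => none.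
  apply: (maxX (fun b => X b \/ b = u)).
    split=> [b Xb|XX]; first by left.
    by move/negP: uP; apply; apply/PE/span_gen/XX; right.
  move=> a /ideal_span_add1[b [r [Xb ->]]] Sb; apply: none.
  by exists b, r.
exists P; split=> [|a Ia|a /PE/goodX//]; last exact/PE/span_base.
split=> [|u v].
  split=> [||r u v /PE uX /PE vX].
  - exact/PE/span_base.
  - by apply/negP => /PE/goodX.
  - by apply/PE/span_add => //; apply: span_mul.
move=> /PE uvX; apply/orP; case: (boolP (u \in P)) => [|uP]; [by left|right].
apply: contraT => vP; have [b [r [bX Sb]]] := meet _ uP.
have [c [s [cX Sc]]] := meet _ vP; case: (goodX _ _ (SM Sb Sc)).
have -> : (b + r * u) * (c + s * v) = c * b + s * v * b + r * u * c + r * s * (u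
  * v).
  rewrite mulrDl !mulrDr mulrC [b * (s * v)]mulrC -!addrA; congr (_ + (_ + (_ +
    _))).
  by rewrite mulrACA.
by do !apply: span_add; apply: span_mul.
Qed.

End PrimeAvoidance.

(** Take a prime that avoids the multiplicative set of the nonzero polynomials
    in the [f]. *)
Lemma independent_prime (K : fieldType) n (I : {mpoly K[n]} -> Prop) t
    (f : 'I_t -> {mpoly K[n]}) :
  I 0 -> (forall a b, I a -> I b -> I (a + b)) -> (forall r a, I a -> I (r * a))
    ->
  independent_mod I f ->
  exists P : {pred {mpoly K[n]}}, [/\ prime_ideal P, forall a, I a -> a \in P
    & independent_mod (fun a => a \in P) f].
Proof.
move=> I0 ID IM fI.
have [||a Ia|P [Pprime IP PS]] := prime_avoiding
    (S := fun a => exists2 F, F != 0 & a = subst f F) I0 ID IM.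
- by exists 1; rewrite ?oner_neq0 ?rmorph1.
- move=> a b [F F0 ->] [G G0 ->]; exists (F * G); rewrite ?mulf_neq0 //.
  by rewrite rmorphM.
- by case=> F /eqP F0 aF; apply/F0/fI; rewrite -aF.
exists P; split=> // F PF; apply/eqP; apply: contraT => F0.
by case: (PS _ PF); exists F.
Qed.

(** * Exactness of the complex *)

(** The remainder [r] of [w] modulo [g] satisfies an equation [c r = g z'],
    whose right-hand side has too large a degree unless both sides vanish. *)
Lemma unit_lead_regular (A : idomainType) (c : A) (g w z : {poly A}) :
  c != 0 -> lead_coef g \is a GRing.unit -> c%:P * w = g * z ->
  exists q, w = g * q.
Proof.
move=> c0 gu cw; have g0 : g != 0.
  by apply: contraTneq gu => ->; rewrite lead_coef0 unitr0.
set q := w %/ g; set r := w %% g.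
have wE : w = q * g + r by exact: Pdiv.IdomainUnit.divp_eq.
exists q; rewrite wE mulrC; have [->|r0] := eqVneq r 0; first by rewrite addr0.
have cr : c%:P * r = g * (z - c%:P * q).
  by rewrite mulrBr -cw wE mulrDr [q * g]mulrC mulrCA addrAC subrr add0r.
have z0 : z - c%:P * q != 0.
  apply: contraTneq r0 => z0; move/eqP: cr.
  by rewrite z0 mulr0 mulf_eq0 polyC_eq0 (negPf c0) /= => ->.
have : (size (c%:P * r)%R < size g)%N by rewrite size_Cmul // ltn_modp.
rewrite cr size_mul //; move: z0; rewrite -size_poly_gt0.
by case: (size (z - _)) => // k _; rewrite addnS ltnNge leq_addr.
Qed.

(** Regularity of a sequence of two elements; it takes the place of unique
    factorization in the divisions below. *)
Lemma regular_pair (R : idomainType) n (c : {mpoly R[n]}) (g w z : {mpoly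
  R[n.+1]}) :
  c != 0 -> lead_coef (muni g) \is a GRing.unit -> mwiden c * w = g * z ->
  exists q, w = g * q.
Proof.
move=> c0 gu /(congr1 (@muni n R)); rewrite !muniM muni_mwiden.
move=> /(unit_lead_regular c0 gu)[q wE]; exists (ofuni q).
by apply: (can_inj (@muniK R n)); rewrite muniM ofuniK.
Qed.

(** A monomial outside the ideal of ['X_a] and ['X_b] stays outside after
    multiplication by a third variable. *)
Lemma koszul_variables (R : idomainType) n (h p q : {mpoly R[n]}) a b e :
  e != a -> e != b -> 'X_e * h = 'X_a * p + 'X_b * q ->
  exists alpha beta, h = 'X_a * alpha + 'X_b * beta.
Proof.
move=> ea eb hE.
pose h1 : {mpoly R[n]} := \sum_(m <- msupp h | (0 < m a)%N) h@_m *: 'X_[m].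
pose h2 : {mpoly R[n]} := \sum_(m <- msupp h | ~~ (0 < m a)%N) h@_m *: 'X_[m].
have hS : h = h1 + h2 by rewrite [LHS]mpolyE (bigID (fun m : 'X_{1..n} => (0 < m
  a)%N)).
have supp P m : m \in msupp (\sum_(m <- msupp h | P m) h@_m *: 'X_[m]) ->
    (m \in msupp h) && P m.
  rewrite -big_filter => /(msupp_sum_le (P := xpredT)).
  case/flattenP=> s /mapP[m' ]; rewrite !mem_filter /= => /andP[Pm' m'h] ->.
  by move=> /msuppZ_le; rewrite msuppX inE => /eqP->; rewrite Pm' m'h.
have [alpha h1E] : exists alpha, h1 = 'X_a ^+ 1 * alpha.
  by apply: mpoly_dvdX => m /supp/andP[].
have [beta h2E] : exists beta, h2 = 'X_b ^+ 1 * beta.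
  apply: mpoly_dvdX => m /supp/andP[mh]; rewrite -leqNgt leqn0 => /eqP ma.
  have : (U_(e) + m)%MM \in msupp ('X_a ^+ 1 * p + 'X_b ^+ 1 * q).
    rewrite !expr1 -hE mulrC (perm_mem (msuppMX _ _)).
    by apply/mapP; exists m.
  move/msuppD_le; rewrite mem_cat => /orP[] /msupp_mulX; rewrite mnmDE mnm1E.
    by rewrite (negPf ea) ma.
  by rewrite (negPf eb).
by exists alpha, beta; rewrite hS h1E h2E !expr1.
Qed.

Section Resolution.
Variables (K : fieldType) (n : nat).
Local Notation R := {mpoly K[n.+3]}.
Local Notation d := n.+3.
Variables (M : 'M[R]_d) (D : 'I_d -> R).
Local Notation x := (\col_(i < d) 'X_i : 'cV[R]_d).
Hypothesis Mx0 : M *m x = 0.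
Hypothesis cofactorM : forall j i, cofactor M j i = D j * 'X_i.
Hypothesis D_neq0 : forall j, D j != 0.

Let detM : \det M = 0.
Proof. by apply: (det_kernel0 (l := ord0)) Mx0 _; rewrite mxE mpolyX_neq0. Qed.

Lemma row_factors_mul : \row_j D j *m M = 0.
Proof.
apply/matrixP => o k; rewrite [RHS]mxE ord1 mxE.
apply: (mulfI (mpolyX_neq0 K U_(@ord0 n.+2)%MM)); rewrite mulr0.
have /matrixP/(_ ord0 k) := mul_adj_mx M.
rewrite detM !mxE mul0rn => adj0; rewrite -[RHS]adj0 mulr_sumr.
by apply: eq_bigr => j _; rewrite !mxE cofactorM mulrA ['X__ * _]mulrC.
Qed.

(** By [cofactor_kernel] the cofactors of a row compare any two coordinates of
    [w]: they are in the ratio of the variables. *)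
Lemma kernel_variables (w : 'cV[R]_d) :
  M *m w = 0 -> exists h : R, w = x *m h%:M.
Proof.
move=> Mw0; pose i1 : 'I_d := lift ord0 ord0.
have prop i l : 'X_i * w l 0 = 'X_l * w i 0.
  have := cofactor_kernel ord0 l i detM Mw0; rewrite !cofactorM.
  rewrite mulrCA [RHS]mulrCA => /(mulfI (D_neq0 _)).
  by rewrite mulrC => ->; rewrite mulrC.
have [h wh] : exists h, w ord0 0 = 'X_ord0 ^+ 1 * h.
  apply: (variables_regular (i := i1) (p := 1) (b := w i1 0)) => //.
  by rewrite !expr1 prop.
exists h; apply/matrixP => i o; rewrite ord1 mul_mx_scalar !mxE.
apply: (mulfI (mpolyX_neq0 K U_(@ord0 n.+2)%MM)).
by rewrite prop wh expr1 mulrCA [h * _]mulrC.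
Qed.

Variables (c : {mpoly K[n.+2]}) (s : 'I_d -> R) (j1 : 'I_d).
Hypotheses (c_neq0 : c != 0) (cE : mwiden c = \sum_l s l * D l).
Hypothesis D_monic : lead_coef (muni (D j1)) \is a GRing.unit.

(** For each [j] the adjugate of [M + delta_mx j l] solves [M w = D_j X_l v]
    with [w_l = 0]. By [kernel_variables] there is only one such solution, so
    the solutions for different [j] differ by the factors [D_j] only. The ideal
    of the [D_j] contains a regular sequence, which allows division by [D_j1]. *)
Lemma variable_mul_image (v : 'cV[R]_d) l : \row_j D j *m v = 0 ->
  exists w : 'cV[R]_d, M *m w = 'X_l *: v.
Proof.
move=> Dv0; pose w j := \adj (M + delta_mx j l) *m v.
have Mwj j : M *m w j = (D j * 'X_l) *: v - w j l 0 *: delta_mx j 0.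
  have : (M + delta_mx j l) *m w j = (D j * 'X_l) *: v.
    by rewrite mulmxA mul_mx_adj det_add_delta detM add0r cofactorM
      mul_scalar_mx.
  move=> <-; rewrite mulmxDl -addrA [X in _ + X](_ : _ = 0) ?addr0 //.
  apply/eqP; rewrite subr_eq0; apply/eqP/matrixP => i o; rewrite ord1 !mxE.
  rewrite (bigD1 l) //= big1 ?mxE ?eqxx ?andbT ?addr0; first by rewrite mulrC.
  by move=> k /negPf kl; rewrite !mxE kl andbF mul0r.
have wl j : w j l 0 = 0.
  have := congr1 (mulmx (\row_j D j)) (Mwj j).
  rewrite mulmxA row_factors_mul mul0mx mulmxBr -!scalemxAr Dv0 scaler0 sub0r.
  move/matrixP/(_ 0 0); rewrite -colE !mxE => /eqP.
  by rewrite eq_sym oppr_eq0 mulf_eq0 (negPf (D_neq0 j)) orbF => /eqP.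
have {}Mwj j : M *m w j = (D j * 'X_l) *: v by rewrite Mwj wl scale0r subr0.
clearbody w.
have Dw i j k : D i * w j k 0 = D j * w i k 0.
  have /kernel_variables[h hE] : M *m (D i *: w j - D j *: w i) = 0.
    rewrite mulmxBr -!scalemxAr (Mwj i) (Mwj j) !scalerA.
    by rewrite mulrCA subrr.
  have h0 : h = 0.
    move/matrixP/(_ l 0): hE; rewrite mul_mx_scalar !mxE !wl !mulr0 subrr.
    move/esym/eqP; rewrite mulf_eq0 (negPf (mpolyX_neq0 _ _)) orbF.
    by move/eqP.
  move/matrixP/(_ k 0): hE; rewrite h0 mul_mx_scalar scale0r !mxE.
  by move/eqP; rewrite subr_eq0 => /eqP.
have /fin_all_exists[q qE] k : exists q, w j1 k 0 = D j1 * q.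
  apply: (regular_pair c_neq0 D_monic (z := \sum_l s l * w l k 0)).
  rewrite cE mulr_suml mulr_sumr; apply: eq_bigr => i _.
  by rewrite -mulrA Dw mulrCA.
exists (\col_k q k); have wq : w j1 = D j1 *: \col_k q k.
  by apply/matrixP => k o; rewrite ord1 qE !mxE.
apply/matrixP => i o; apply: (mulfI (D_neq0 j1)).
have /matrixP/(_ i o) := Mwj j1; rewrite wq -scalemxAr -scalerA.
by rewrite mxE [RHS]mxE.
Qed.

(** Solutions [p] and [q] for [X_a v] and [X_b v] fail to come from one solution
    for [v] by a multiple [h] of [x]. A third variable shows that [h] lies in
      the
    ideal of [X_a] and [X_b]; so [p] can be corrected by a multiple of [x] to
    become divisible by [X_a]. *)
Lemma syzygies_factors (v : 'cV[R]_d) : \row_j D j *m v = 0 ->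
  exists w, v = M *m w.
Proof.
move=> Dv0; pose a : 'I_d := ord0; pose b : 'I_d := lift ord0 ord0.
pose e : 'I_d := ord_max.
have [p Mp] := variable_mul_image a Dv0.
have [q Mq] := variable_mul_image b Dv0.
have /kernel_variables[h hE] : M *m ('X_b *: p - 'X_a *: q) = 0.
  by rewrite mulmxBr -!scalemxAr Mp Mq !scalerA mulrC subrr.
have {}hE i : 'X_b * p i 0 - 'X_a * q i 0 = 'X_i * h.
  by move/matrixP/(_ i 0): hE; rewrite mul_mx_scalar !mxE => ->; rewrite mulrC.
have [alpha [beta hab]] : exists alpha beta, h = 'X_a * alpha + 'X_b * beta.
  apply: (koszul_variables (e := e) (p := - q e 0) (q := p e 0)) => //.
  by rewrite -hE addrC mulrN.
have /fin_all_exists[r rE] i : exists r, p i 0 - 'X_i * beta = 'X_a ^+ 1 * r.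
  apply: (variables_regular (i := b) (p := 1)
    (b := q i 0 + 'X_i * alpha)) => //.
  rewrite !expr1 mulrBr mulrDr; apply/eqP; rewrite subr_eq -addrA addrC
    -subr_eq.
  by rewrite hE hab mulrDr !(mulrCA 'X_i).
exists (\col_i r i); apply/matrixP => i o.
apply: (mulfI (mpolyX_neq0 K U_(a)%MM)).
have pE : p = 'X_a *: \col_i r i + x *m beta%:M.
  apply/matrixP => k o'; rewrite mul_mx_scalar ord1 !mxE.
  by have := rE k; rewrite expr1 => <-; rewrite [beta * _]mulrC subrK.
have /matrixP/(_ i o) := Mp; rewrite pE mulmxDr mulmxA Mx0 mul0mx addr0
  -scalemxAr.
by rewrite mxE [RHS]mxE => ->.
Qed.

End Resolution.

(** * The ideal of maximal minors *)

Lemma mpoly_scaleAr (R : comNzRingType) n a (p q : {mpoly R[n]}) :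
  p * (a *: q) = a *: (p * q).
Proof. by rewrite mulrC -mpoly_scaleAl mulrC. Qed.

(** ** Leading forms for a measure *)
Section TopForm.
Variables (R : comNzRingType) (n : nat) (mf : measure n).
Implicit Types (p q : {mpoly R[n]}).

(** The bound on the rest makes [p0] depend on [p] and [k] only, so that leading
    forms can be compared ([top_form_unique]). *)
Definition top_form k p p0 : Prop :=
  p0 \is k.-homog for mf /\ {in msupp (p - p0), forall m, (mf m < k)%N}.

Lemma top_form_homog k p : p \is k.-homog for mf -> top_form k p p.
Proof. by move=> hp; split=> // m; rewrite subrr msupp0. Qed.

Lemma top_form_unique k p p0 p1 : top_form k p p0 -> top_form k p p1 -> p0 = p1.
Proof.
move=> [h0 l0] [h1 l1]; apply/eqP; rewrite -subr_eq0; apply/eqP/mpolyP => m.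
rewrite mcoeff0; have h01 : p0 - p1 \is k.-homog for mf by apply: rpredB.
case: (eqVneq (mf m) k) => [mk|]; last exact: dhomog_nemf_coeff.
apply: memN_msupp_eq0; apply/negP.
have -> : p0 - p1 = (p - p1) - (p - p0) by rewrite opprB [RHS]addrC subrKA.
by move/msuppB_le; rewrite mem_cat => /orP[/l1|/l0]; rewrite mk ltnn.
Qed.

Lemma top_form0 k p : top_form k p 0 -> {in msupp p, forall m, (mf m < k)%N}.
Proof. by case=> _; rewrite subr0. Qed.

Lemma top_form_lt k p : {in msupp p, forall m, (mf m < k)%N} -> top_form k p 0.
Proof. by move=> pk; split; rewrite ?rpred0 ?subr0. Qed.

Lemma top_form_le k p p0 : top_form k p p0 -> {in msupp p, forall m, (mf m <=
  k)%N}.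
Proof.
move=> [/dhomogP h0 l0] m; rewrite -[p](subrK p0) => /msuppD_le.
by rewrite mem_cat => /orP[/l0/ltnW//|/h0->].
Qed.

Lemma top_form_pihomog k p : {in msupp p, forall m, (mf m <= k)%N} ->
  top_form k p (pihomog mf k p).
Proof.
move=> pk; split=> [|m mp]; first exact: pihomogP.
have coefpi : (pihomog mf k p)@_m = if mf m == k then p@_m else 0.
  rewrite pihomogE raddf_sum /=; case: eqP => mk.
    rewrite [in RHS](mpolyE p) raddf_sum /= big_mkcond /=.
    apply: eq_bigr => m' _; case: eqP => // m'k.
    rewrite mcoeffZ mcoeffX; case: eqP => [m'm|]; last by rewrite mulr0.
    by case: m'k; rewrite m'm.
  rewrite big1 // => m' /eqP m'k; rewrite mcoeffZ mcoeffX.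
  by case: eqP => [m'm|]; [case: mk; rewrite -m'm|rewrite mulr0].
have : (mf m <= k)%N.
  have /msuppB_le := mp.
  rewrite mem_cat => /orP[/pk//|].
  by move/(dhomog_mf (pihomogP mf k p)) => ->.
rewrite leq_eqVlt => /orP[mk|//].
by move: mp; rewrite mcoeff_msupp mcoeffB coefpi mk subrr eqxx.
Qed.

Lemma top_formD k p p0 q q0 :
  top_form k p p0 -> top_form k q q0 -> top_form k (p + q) (p0 + q0).
Proof.
move=> [hp lp] [hq lq]; split=> [|m]; first exact: rpredD.
rewrite opprD addrACA => /msuppD_le; rewrite mem_cat.
by case/orP=> [/lp|/lq].
Qed.

Lemma top_formB k p p0 q q0 :
  top_form k p p0 -> top_form k q q0 -> top_form k (p - q) (p0 - q0).
Proof.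
move=> tp [hq lq]; apply: top_formD => //; split=> [|m]; first by rewrite
  rpredN.
by rewrite -opprD (perm_mem (msuppN _)) => /lq.
Qed.

Lemma top_form_sum k (I : Type) (r : seq I) (F F0 : I -> {mpoly R[n]}) :
  (forall i, top_form k (F i) (F0 i)) ->
  top_form k (\sum_(i <- r) F i) (\sum_(i <- r) F0 i).
Proof.
move=> FF0; elim: r => [|i r IH]; last by rewrite !big_cons; apply: top_formD.
by rewrite !big_nil; apply/top_form_homog/rpred0.
Qed.

Lemma top_formM k l p p0 q q0 :
  top_form k p p0 -> top_form l q q0 -> top_form (k + l) (p * q) (p0 * q0).
Proof.
move=> tp tq; have [hp lp] := tp; have [hq lq] := tq.
split=> [|m]; first exact: dhomogM.
have -> : p * q - p0 * q0 = (p - p0) * q + p0 * (q - q0).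
  by rewrite mulrBl mulrBr addrA subrK.
move/msuppD_le; rewrite mem_cat => /orP[] /msuppM_le/allpairsP[[m1 m2]] /= [m1P
  m2P ->];
  rewrite mfD.
- by rewrite -addSn leq_add ?(lp _ m1P) ?(top_form_le tq).
- by rewrite (dhomog_mf hp m1P) ltn_add2l; apply: lq.
Qed.

Lemma top_form_prod (I : Type) (r : seq I) (F F0 : I -> {mpoly R[n]}) :
  (forall i, top_form 1 (F i) (F0 i)) ->
  top_form (size r) (\prod_(i <- r) F i) (\prod_(i <- r) F0 i).
Proof.
move=> FF0; elim: r => [|i r IH]; last by rewrite !big_cons; apply: (@top_formM
  1).
by rewrite !big_nil; apply/top_form_homog/dhomog1.
Qed.

Lemma top_form_sign k p p0 b : top_form k p p0 -> top_form k ((-1) ^+ b * p)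
  ((-1) ^+ b * p0).
Proof.
move=> tp; rewrite -[k]add0n; apply: top_formM => //; apply: top_form_homog.
have -> : (-1 : {mpoly R[n]}) ^+ b = ((-1) ^+ b)%:MP.
  by rewrite rmorphXn /= mpolyCN mpolyC1.
by rewrite -[_%:MP]mulr1 mul_mpolyC; apply: dhomogZ; apply: dhomog1.
Qed.

Lemma top_form_det k (A A0 : 'M[{mpoly R[n]}]_k) :
  (forall i j, top_form 1 (A i j) (A0 i j)) -> top_form k (\det A) (\det A0).
Proof.
move=> AA0; apply: top_form_sum => s; apply: top_form_sign.
have sk : size (index_enum 'I_k) = k by rewrite /index_enum -enumT
  size_enum_ord.
by rewrite -[X in top_form X _ _]sk; apply: top_form_prod => i; apply: AA0.
Qed.

End TopForm.

Section PartialDegree.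
Variables (n : nat) (u v : 'I_n).

Definition partial_degree (m : 'X_{1..n}) : nat := m u + m v.

Lemma partial_degree0 : partial_degree 0%MM = 0%N.
Proof. by rewrite /partial_degree !mnm0E. Qed.

Lemma partial_degreeD : {morph partial_degree : m1 m2 / (m1 + m2)%MM >-> (m1 +
  m2)%N}.
Proof. by move=> m1 m2; rewrite /partial_degree !mnmDE addnACA. Qed.

HB.instance Definition _ :=
  isMeasure.Build n partial_degree partial_degree0 partial_degreeD.

End PartialDegree.

(** Let [x] and [y] be the combinations of [a] whose coefficients turn [delta] into
    the two powers. Proportionality gives [X_v ^ e x = X_u ^ d y], so [X_u ^ d]
    divides [x], and the quotient is the factor sought. *)
Lemma proportional_to_primary (R : idomainType) n (I : finType)
    (delta a : I -> {mpoly R[n]}) (p q : I -> R) (u v : 'I_n) d e :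
  u != v -> (forall i k, delta i * a k = delta k * a i) ->
  \sum_i p i *: delta i = 'X_u ^+ d -> \sum_i q i *: delta i = 'X_v ^+ e ->
  exists beta, (forall i, a i = delta i * beta) /\
    \sum_i p i *: a i = 'X_u ^+ d * beta.
Proof.
move=> uv prop pE qE.
have mulE (r : I -> R) k : (\sum_i r i *: delta i) * a k
    = delta k * \sum_i r i *: a i.
  rewrite mulr_suml mulr_sumr; apply: eq_bigr => i _.
  by rewrite -mpoly_scaleAl (prop i k) mpoly_scaleAr.
have [beta bE] : exists beta, \sum_i p i *: a i = 'X_u ^+ d * beta.
  apply: (variables_regular (i := v) (p := e) (b := \sum_i q i *: a i)).
    by rewrite eq_sym.
  rewrite -qE mulr_suml [RHS]mulr_sumr; apply: eq_bigr => k _.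
  by rewrite -mpoly_scaleAl mpoly_scaleAr -pE mulE.
exists beta; split=> // k.
apply: (mulfI (expf_neq0 d (mpolyX_neq0 R U_(u)%MM))).
by rewrite -{1}pE mulE bE mulrCA.
Qed.

Lemma sum_sub_multiple (R : comNzRingType) (I : finType) (a b c : I -> R) t :
  \sum_i b i * c i = 0 -> \sum_i (a i - b i * t) * c i = \sum_i a i * c i.
Proof.
move=> bc; under eq_bigr => i _ do rewrite mulrBl mulrAC.
by rewrite sumrB -mulr_suml bc mul0r subr0.
Qed.

Definition line_matrix (A : comNzRingType) d (c : 'M['rV[A]_d]_(d.+1, d))
    (u v : 'I_d) : 'M[{poly A}]_(d.+1, d) :=
  \matrix_(i, j) ((c i j 0 u)%:P + c i j 0 v *: 'X).

Definition minor_coefs (A : comNzRingType) d (c : 'M['rV[A]_d]_(d.+1, d))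
    (u v : 'I_d) : 'M[A]_d.+1 :=
  \matrix_(i, k) (maximal_minor (line_matrix c u v) i)`_k.

Section MinorsIdeal.
Variables (K : fieldType) (d : nat) (c : 'M['rV[K]_d]_(d.+1, d)) (u v : 'I_d).
Hypothesis uv : u != v.
Local Notation R := {mpoly K[d]}.
Local Notation L := (linear_matrix c).
Local Notation Delta := (maximal_minor L).
Local Notation uvdeg := (partial_degree u v).

Definition matrix_uv : 'M[R]_(d.+1, d) :=
  \matrix_(i, j) (c i j 0 u *: 'X_u + c i j 0 v *: 'X_v).

Local Notation line_matrix := (line_matrix c u v).
Local Notation minor_coefs := (minor_coefs c u v).

Local Notation delta := (maximal_minor matrix_uv).

Lemma matrix_uv_top i j : top_form uvdeg 1 (L i j) (matrix_uv i j).
Proof.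
have X1 l : l = u \/ l = v -> ('X_l : R) \is 1.-homog for uvdeg.
  case=> ->; rewrite dhomogX /= /partial_degree !mnm1E eqxx.
    by rewrite (negPf uv).
  by rewrite [v == u]eq_sym (negPf uv).
split=> [|m].
  by rewrite mxE; apply: rpredD; apply: dhomogZ; apply: X1; [left|right].
rewrite !mxE (bigD1 u) //= (bigD1 v) 1?eq_sym //= addrA [X in msupp X]addrAC
  subrr add0r.
rewrite -big_filter => /(msupp_sum_le (P := xpredT)).
case/flattenP=> s /mapP[l]; rewrite !mem_filter /= => /andP[/andP[lu lv] _] ->.
move=> /msuppZ_le; rewrite msuppX inE => /eqP->.
by rewrite /= /partial_degree !mnm1E (negPf lu) (negPf lv).
Qed.

Lemma minor_uv_top i : top_form uvdeg d (Delta i) (delta i).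
Proof.
rewrite !maximal_minorE; apply: top_form_sign; apply: top_form_det => a b.
by rewrite !mxE; have := matrix_uv_top (lift i a) b; rewrite !mxE.
Qed.

Lemma line_restriction_linear i j : line_restriction u v (L i j) = line_matrix i
  j.
Proof.
rewrite !mxE rmorph_sum (bigD1 u) //= (bigD1 v) 1?eq_sym //= big1 ?addr0.
  rewrite !line_restrictionZ !line_restrictionX /line_value eqxx [v == u]eq_sym.
  by rewrite (negPf uv) eqxx alg_polyC.
move=> l /andP[lu lv]; rewrite line_restrictionZ line_restrictionX /line_value.
by rewrite (negPf lu) (negPf lv) scaler0.
Qed.

Lemma line_restriction_minor i :
  line_restriction u v (Delta i) = maximal_minor line_matrix i.
Proof.
rewrite [LHS]map_maximal_minor; congr maximal_minor.
by apply/matrixP => a b; rewrite mxE -line_restriction_linear.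
Qed.

Lemma line_restriction_minor_uv i :
  line_restriction u v (delta i) = maximal_minor line_matrix i.
Proof.
rewrite [LHS]map_maximal_minor; congr maximal_minor; apply/matrixP => a b.
rewrite !mxE /= rmorphD /= !line_restrictionZ !line_restrictionX /line_value
  eqxx.
by rewrite [v == u]eq_sym (negPf uv) eqxx alg_polyC.
Qed.

Hypothesis minor_coefs_unit : minor_coefs \in unitmx.

(** Binary forms of degree [d] are determined by their dehomogenization, so
    the minors of the pencil span all of them. *)
Lemma minors_uv_span (e : 'I_d.+1) :
  exists p : 'I_d.+1 -> K,
    \sum_i p i *: delta i = 'X_u ^+ (d - e) * 'X_v ^+ e.
Proof.
pose w : 'rV[K]_d.+1 := delta_mx 0 e *m invmx minor_coefs.
exists (fun i => w 0 i); apply/eqP; rewrite -subr_eq0; set h := _ - _;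
  apply/eqP.
have Xd : ('X_u ^+ (d - e) * 'X_v ^+ e : R) \is d.-homog.
  rewrite !mpolyXn -mpolyXD dhomogX /= mdegD !mdegMn !mdeg1 !mul1n.
  by rewrite subnK // -ltnS.
have Xuv : ('X_u ^+ (d - e) * 'X_v ^+ e : R) \is d.-homog for uvdeg.
  rewrite !mpolyXn -mpolyXD dhomogX /= /partial_degree !mnmDE !mulmnE !mnm1E.
  rewrite !eqxx [v == u]eq_sym (negPf uv).
  by rewrite !mul1n !mul0n addn0 add0n subnK // -ltnS.
have hdeg : h \is d.-homog.
  apply: rpredB => //; apply: rpred_sum => i _; apply: dhomogZ.
  have -> : delta i = (-1) ^+ i *: \det (row' i matrix_uv).
    by rewrite maximal_minorE -mul_mpolyC rmorphXn /= mpolyCN mpolyC1.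
  apply: dhomogZ; have [] := @top_form_det K d mdeg d (row' i matrix_uv) (row' i
    matrix_uv) => //.
  move=> a b; apply: top_form_homog; rewrite !mxE.
  by apply: rpredD; apply: dhomogZ; rewrite dhomogX /= mdeg1.
have huv : h \is d.-homog for uvdeg.
  apply: rpredB => //; apply: rpred_sum => i _; apply: dhomogZ.
  by case: (minor_uv_top i).
have h0 : line_restriction u v h = 0.
  apply/polyP => k; rewrite coef0; case: (leqP k d) => [kd|dk]; last first.
    by rewrite (coef_line_restriction uv _ hdeg) leqNgt dk.
  rewrite rmorphB rmorph_sum /= coefB coef_sum rmorphM !rmorphXn /=.
  rewrite !line_restrictionX /line_value eqxx [v == u]eq_sym (negPf uv) eqxx.
  rewrite expr1n mul1r coefXn.
  have /matrixP/(_ 0 (Ordinal (kd : k < d.+1)%N)) : w *m minor_coefs = delta_mx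
    0 e.
    by rewrite -mulmxA mulVmx // mulmx1.
  rewrite !mxE -val_eqE /= => <-; apply/eqP; rewrite subr_eq0; apply/eqP.
  apply: eq_bigr => i _; rewrite line_restrictionZ coefZ
    line_restriction_minor_uv.
  by rewrite mxE [minor_coefs _ _]mxE.
apply/mpolyP => m; rewrite mcoeff0; apply/eqP; apply: contraT => hm.
have mh : m \in msupp h by rewrite mcoeff_msupp.
have md : mdeg m = d := dhomog_mf hdeg mh.
have muv : (m u + m v = d)%N := dhomog_mf huv mh.
have mv : (m v <= d)%N by apply: leq_trans (leq_addl (m u) _) _; rewrite muv.
have dmv : (d - m v = m u)%N by apply/eqP; rewrite -(eqn_add2r (m v)) subnK //
  muv.
have := coef_line_restriction uv (m v) hdeg; rewrite h0 coef0 mv dmv.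
suff -> : (U_(u) *+ m u + U_(v) *+ m v)%MM = m.
  by move=> h0m; rewrite -h0m eqxx in hm.
apply/mnmP => i; rewrite mnmDE !mulmnE !mnm1E.
have [<-|iu] := eqVneq u i.
  by rewrite [v == u]eq_sym (negPf uv) mul1n mul0n addn0.
have [<-|iv] := eqVneq v i; first by rewrite mul0n mul1n.
have mE : (m u + m v = mdeg m)%N by rewrite muv.
rewrite !mul0n; apply/esym/eqP; rewrite -leqn0 -(leq_add2l (m u + m v)) addn0
  [leqRHS]mE.
rewrite mdegE (bigD1 u) //= (bigD1 v) 1?eq_sym //=.
by rewrite (bigD1 i) ?[i == _]eq_sym ?iu ?iv //= !addnA leq_addr.
Qed.

Lemma kernel_matrix_uv (a : 'I_d.+1 -> R) :
  (forall j, \sum_i a i * matrix_uv i j = 0) ->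
  exists beta, (forall i, a i = delta i * beta) /\
    exists p : 'I_d.+1 -> K, \sum_i p i *: a i = 'X_u ^+ d * beta.
Proof.
move=> aL; have [p pE] := minors_uv_span ord0; have [q qE] := minors_uv_span
  ord_max.
rewrite /= subn0 expr0 mulr1 in pE; rewrite /= subnn expr0 mul1r in qE.
suff prop i k : delta i * a k = delta k * a i.
  have [beta [aE bE]] := proportional_to_primary uv prop pE qE.
  by exists beta; split=> //; exists p.
have := @kernel_minors _ _ matrix_uv (\row_i a i) i k; rewrite !mxE; apply.
apply/matrixP => o j; rewrite [RHS]mxE -[RHS](aL j) mxE.
by apply: eq_bigr => l _; rewrite mxE.
Qed.

(** If a row [a L] has no [u] or [v], its part of highest degree in these
    variables is killed by the pencil, hence is a multiple of the minors of
    the pencil; subtracting the same multiple of the minors of [L] from [a]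
    does not change [a L] and lowers the degree. *)
Lemma row_image_free (G : 'I_d -> R) (a : 'I_d.+1 -> R) j :
  (forall l, G l \is 0.-homog for uvdeg) ->
  (forall l, \sum_i a i * L i l = G l) -> G j = 0.
Proof.
move=> G0; have [e] : exists e, forall i, {in msupp (a i), forall m, (uvdeg m <
  e)%N}.
  exists (\max_i mmeasure uvdeg (a i))%N => i m ma.
  by apply: leq_trans (mmeasure_mnm_lt _ ma) _; rewrite (bigD1 i) //= leq_maxl.
elim: e a => [|e IH] a ae aL.
  rewrite -aL big1 // => i _; suff -> : a i = 0 by rewrite mul0r.
  by apply/eqP; rewrite -msupp_eq0; case: (msupp (a i)) (ae i) => // m s /(_ m
    (mem_head _ _)).
pose al i := pihomog uvdeg e (a i).
have atop i : top_form uvdeg e (a i) (al i) by apply/top_form_pihomog/ae.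
have alL l : \sum_i al i * matrix_uv i l = 0.
  have top1 : top_form uvdeg (e + 1) (G l) (\sum_i al i * matrix_uv i l).
    rewrite -aL; apply: top_form_sum => i; apply: top_formM => //.
    exact: matrix_uv_top.
  apply: (top_form_unique top1); apply: top_form_lt => m mG.
  by rewrite addn1 (dhomog_mf (G0 l) mG).
have [beta [alE [p pE]]] := kernel_matrix_uv alL.
have bdeg m : m \in msupp beta -> (d + uvdeg m)%N = e.
  move=> mb; have ph : \sum_i p i *: al i \is e.-homog for uvdeg.
    by apply: rpred_sum => i _; apply: dhomogZ; case: (atop i).
  have : (U_(u) *+ d + m)%MM \in msupp (\sum_i p i *: al i).
    rewrite pE mpolyXn mulrC (perm_mem (msuppMX _ _)).
    by apply/mapP; exists m.
  move=> /(dhomog_mf ph) /= <-; rewrite /partial_degree !mnmDE !mulmnE !mnm1E.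
  by rewrite eqxx (negPf uv) mul1n mul0n add0n addnA.
have btop i : top_form uvdeg e (Delta i * beta) (delta i * beta).
  have := minor_uv_top i; move: (Delta i) (delta i) => P P0 PP0.
  have [->|b0] := eqVneq beta 0; first by rewrite !mulr0;
    apply/top_form_homog/dhomog0.
  have [m0 m0b] : exists m, m \in msupp beta by exists (mlead beta); apply:
    mlead_supp.
  rewrite -(bdeg _ m0b); apply: top_formM => //.
  apply/top_form_homog/dhomogP => m mb; apply/eqP.
  by rewrite -(eqn_add2l d) !bdeg.
apply: (IH (fun i => a i - Delta i * beta)) => [i|l].
  apply: top_form0; have := top_formB (atop i) (btop i).
  by rewrite (_ : al i - delta i * beta = 0) // alE; apply: subrr.
rewrite -aL; apply: (sum_sub_multiple a beta); exact: minors_syzygy.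
Qed.

Definition minors_ideal (F : R) : Prop := exists b : 'I_d.+1 -> R,
  F = \sum_i b i * Delta i.

(** Multiplication by an element of the ideal of minors sends every row into
    the row space of [L]. *)
Lemma minors_ideal_free F :
  minors_ideal F -> F \is 0.-homog for uvdeg -> F = 0.
Proof.
move=> [b FE] F0; pose w : 'rV[R]_d := delta_mx 0 u.
have /fin_all_exists[a aE] i := minor_in_row_image L i w.
pose G l := F * w 0 l; rewrite -[F]mulr1.
have -> : 1 = w 0 u by rewrite mxE !eqxx.
apply: (@row_image_free G (fun k => \sum_i b i * a i 0 k) u) => l.
  rewrite /G mxE eqxx /=; case: eqP => _; first by rewrite mulr1.
  by rewrite mulr0 rpred0.
under eq_bigr => k _ do rewrite mulr_suml.
rewrite exchange_big /G FE mulr_suml; apply: eq_bigr => i _ /=.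
have /matrixP/(_ 0 l) := aE i; rewrite [RHS]mxE [LHS]mxE -mulrA => <-.
by rewrite mulr_sumr; apply: eq_bigr => k _; rewrite mulrA.
Qed.

End MinorsIdeal.

Lemma subst_variables_inj (K : fieldType) n t (phi : 'I_t -> 'I_n) F :
  injective phi -> subst (fun k => 'X_(phi k) : {mpoly K[n]}) F = 0 -> F = 0.
Proof.
move=> phi_inj F0.
pose psi (i : 'I_n) : {mpoly K[t]} := if [pick k | phi k == i] is Some k then
  'X_k else 0.
rewrite -[LHS]/(idfun F) -(rmorph0 (mmap (@mpolyC t K) psi)) -F0.
apply: (mpoly_rmorphism_ext (f := idfun)
  (g := mmap (@mpolyC t K) psi \o subst (fun k => 'X_(phi k)))) => [c|k] /=.
  by rewrite substC mmapC.
rewrite substX mmapX mmap1U /psi; case: pickP => [l /eqP/phi_inj->//|/(_ k)].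
by rewrite eqxx.
Qed.

(** Since the ideal of minors contains no nonzero polynomial without [u] and
    [v], the other variables are independent modulo some prime over it. *)
Lemma minors_prime (K : fieldType) n (c : 'M['rV[K]_n.+3]_(n.+4, n.+3)) :
  minor_coefs c ord0 ord_max \in unitmx ->
  exists P : {pred {mpoly K[n.+3]}},
    [/\ prime_ideal P, forall i, maximal_minor (linear_matrix c) i \in P,
        forall k : 'I_n.+1, 'X_(lift ord0 (widen_ord (leqnSn _) k)) \notin P
      & ~ height_ge P 3].
Proof.
move=> cu; pose phi (k : 'I_n.+1) : 'I_n.+3 := lift ord0 (widen_ord (leqnSn _)
  k).
have phi_inj : injective phi.
  by move=> k l /lift_inj/(congr1 val) /= /val_inj.
have phiu k : phi k != ord0 by rewrite eq_sym neq_lift.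
have phiv k : phi k != ord_max.
  by rewrite -val_eqE /= /bump /= add1n eqSS neq_ltn ltn_ord.
pose f (k : 'I_n.+1) : {mpoly K[n.+3]} := 'X_(phi k).
have uv : (ord0 : 'I_n.+3) != ord_max by [].
have fdeg F : subst f F \is 0.-homog for (partial_degree (ord0 : 'I_n.+3)
  ord_max).
  apply: rpred_sum => m _; rewrite mul_mpolyC; apply: dhomogZ.
  rewrite /mmap1; elim/big_ind: _ => [|p q hp hq|k _]; first exact: dhomog1.
    exact: (dhomogM hp hq).
  rewrite /f mpolyXn dhomogX /= /partial_degree !mulmnE !mnm1E.
  by rewrite (negPf (phiu k)) (negPf (phiv k)).
have [||r a [b ->]||P [Pprime DP fP]] := @independent_prime K n.+3 (minors_ideal
  c) _ f.
- by exists (fun=> 0); rewrite big1 // => i _; rewrite mul0r.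
- move=> _ _ [a ->] [b ->]; exists (fun i => a i + b i).
  by rewrite -big_split; apply: eq_bigr => i _; rewrite mulrDl.
- by exists (fun i => r * b i); rewrite mulr_sumr; apply: eq_bigr => i _;
    rewrite mulrA.
- move=> F FD; apply: (subst_variables_inj phi_inj).
  exact: (minors_ideal_free uv cu FD (fdeg F)).
exists P; split=> // [i|k|].
- apply: DP; exists (fun k => (k == i)%:R).
  rewrite (bigD1 i) //= eqxx mul1r big1 ?addr0 // => k /negPf->.
  by rewrite mul0r.
- apply/negP => Pk; have := fP 'X_k; rewrite substX => /(_ Pk)/eqP.
  by rewrite (negPf (mpolyX_neq0 _ _)).
- move=> /(independent_height_le fP); by rewrite addn3 ltnn.
Qed.

(** * Inversion factors of a single matrix *)

Section Homogeneity.
Variables (R : comNzRingType) (n : nat).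

Lemma dhomog_prod_const l (I : Type) (r : seq I) (F : I -> {mpoly R[n]}) :
  (forall i, F i \is l.-homog) -> \prod_(i <- r) F i \is (size r * l).-homog.
Proof.
move=> Fl; elim: r => [|i r IH]; first by rewrite big_nil dhomog1.
by rewrite big_cons mulSn; apply: dhomogM.
Qed.

Lemma dhomog_det k l (A : 'M[{mpoly R[n]}]_k) :
  (forall i j, A i j \is l.-homog) -> \det A \is (k * l).-homog.
Proof.
move=> Al; apply: rpred_sum => s _.
have -> (b : bool) : (-1 : {mpoly R[n]}) ^+ b = ((-1) ^+ b)%:MP.
  by rewrite rmorphXn /= mpolyCN mpolyC1.
rewrite mul_mpolyC; apply: dhomogZ.
have sk : size (index_enum 'I_k) = k by rewrite /index_enum -enumT
  size_enum_ord.
by rewrite -[X in (X * l)%N]sk; apply: dhomog_prod_const => i; apply: Al.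
Qed.

Lemma dhomog_divX l (p : {mpoly R[n]}) i :
  'X_i * p \is l.+1.-homog -> p \is l.-homog.
Proof.
move=> /dhomogP hp; apply/dhomogP => m mp; apply: succn_inj.
have : (U_(i) + m)%MM \in msupp ('X_i * p).
  by rewrite mulrC (perm_mem (msuppMX _ _)); apply/mapP; exists m.
by move/hp; rewrite /= mdegD mdeg1.
Qed.

Lemma mcoeff_muni (p : {mpoly R[n.+1]}) k m :
  ((muni p)`_k)@_m = p@_(mnmwiden m + U_(ord_max) *+ k).
Proof.
rewrite muniE coef_sum raddf_sum /= [in RHS](mpolyE p) raddf_sum /=.
apply: eq_bigr => m' _; rewrite !coefZ coefXn mcoeffZ mcoeffX.
rewrite mulr_natr mcoeffMn mcoeffZ mcoeffX -mulrnAr -mulrnA mulnb; congr (_ *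
  _%:R).
congr nat_of_bool; set t := [multinom _ | i < n].
have maxw i : (ord_max == widen_ord (leqnSn n) i) = false.
  by apply/eqP=> /(congr1 val) /= e; have := ltn_ord i; rewrite -e ltnn.
apply/andP/eqP => [[/eqP<- /eqP->]|m'E].
  apply/mnmP => i; rewrite mnmDE mulmnE mnm1E.
  case: (ord_max_or_widen i) => [->|[j ->]].
    by rewrite mnmwiden_ordmax eqxx mul1n.
  by rewrite mnmwiden_widen maxw mul0n addn0 mnmE.
split; last by rewrite m'E mnmDE mulmnE mnm1E eqxx mnmwiden_ordmax mul1n.
apply/eqP/mnmP => i.
by rewrite mnmE m'E mnmDE mulmnE mnm1E maxw mnmwiden_widen mul0n addn0.
Qed.

(** In a form of degree [k] only a constant can multiply the [k]-th power of
    the last variable. *)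
Lemma lead_muni_homog (p : {mpoly R[n.+1]}) k : p \is k.-homog ->
  (size (muni p) <= k.+1)%N /\ (muni p)`_k = (p@_(U_(ord_max) *+ k))%:MP.
Proof.
move=> hp; have deg m l : (mdeg (mnmwiden m + U_(ord_max) *+ l) = mdeg m + l)%N.
  rewrite mdegD mdegMn mdeg1 mul1n; congr (_ + _)%N.
  rewrite !mdegE big_ord_recr /= mnmwiden_ordmax addn0.
  by apply: eq_bigr => i _; rewrite mnmwiden_widen.
split.
  apply/leq_sizeP => l kl; apply/mpolyP => m; rewrite mcoeff_muni mcoeff0.
  apply: (dhomog_nemf_coeff hp); rewrite /= deg.
  by rewrite gtn_eqF // (leq_trans kl) // leq_addl.
apply/mpolyP => m; rewrite mcoeff_muni mcoeffC.
case: eqP => [->|m0]; first by rewrite mnmwiden0 add0m mulr1.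
rewrite mulr0; apply: (dhomog_nemf_coeff hp); rewrite /= deg -[k in _ !=
  k]add0n.
by rewrite eqn_add2r mdeg_eq0; apply/eqP.
Qed.

End Homogeneity.

Lemma map_resultant_rmorphism (A B : nzRingType) (f : {rmorphism A -> B})
    (p q : {poly A}) :
  f (lead_coef p) != 0 -> f (lead_coef q) != 0 ->
  f (resultant p q) = resultant (map_poly f p) (map_poly f q).
Proof.
move=> fp fq; rewrite /resultant /Sylvester_mx !size_map_poly_id0 //.
rewrite -det_map_mx /= map_col_mx; congr (\det (col_mx _ _));
  by apply: map_lin1_mx => v; rewrite map_poly_rV rmorphM /= map_rVpoly.
Qed.


Lemma eliminate_last (R : comNzRingType) n (g h : {mpoly R[n.+1]}) :
  (1 < size (muni g))%N -> (1 < size (muni h))%N ->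
  exists a b, mwiden (resultant (muni g) (muni h)) = a * g + b * h.
Proof.
move=> sg sh; have [[a b] _ /= resE] := resultant_in_ideal sg sh.
exists (ofuni a), (ofuni b).
apply: (can_inj (@muniK R n)).
by rewrite muniD !muniM !ofuniK muni_mwiden resE.
Qed.

(** The cofactors of a row are proportional to the variables, two of which form
    a regular sequence. *)
Lemma cofactors_variables (R : idomainType) n (M : 'M[{mpoly R[n.+2]}]_n.+2) j :
  M *m (\col_i 'X_i) = 0 ->
  exists D, forall i, cofactor M j i = D * 'X_i.
Proof.
move=> Mx0; have detM : \det M = 0.
  by apply: (det_kernel0 (l := ord0)) Mx0 _; rewrite mxE mpolyX_neq0.
have prop l i : 'X_l * cofactor M j i = 'X_i * cofactor M j l.
  by have := cofactor_kernel j l i detM Mx0; rewrite !mxE.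
move: (cofactor M j) prop => C prop.
have [D DE] : exists D, C ord0 = 'X_ord0 ^+ 1 * D.
  apply: (variables_regular (i := lift ord0 ord0) (p := 1)
    (b := C (lift ord0 ord0))) => //.
  by rewrite !expr1 prop.
exists D => i; apply: (mulfI (mpolyX_neq0 R U_(@ord0 n.+1)%MM)).
by rewrite prop DE expr1 mulrCA [D * _]mulrC.
Qed.

(** ** Matrices of linear forms with good restriction to a line *)

(** The restriction of [Psi] to the line. *)
Definition line_jacobian (A : comNzRingType) d (c : 'M['rV[A]_d]_(d.+1, d))
    (u v : 'I_d) : 'M[{poly A}]_d :=
  \matrix_(j, l) \sum_i (c i j 0 l)%:P * maximal_minor (line_matrix c u v) i.

(** The restriction of the [j]-th inversion factor to the line, because the
    variable [u] is 1 there. *)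
Definition line_factor (A : comNzRingType) d (c : 'M['rV[A]_d]_(d.+1, d))
    (u v j : 'I_d) : {poly A} := cofactor (line_jacobian c u v) j u.

Section OneMatrix.
Variables (K : fieldType) (n : nat).
Local Notation d := n.+3.
Local Notation R := {mpoly K[d]}.
Variable c : 'M['rV[K]_d]_(d.+1, d).
Local Notation L := (linear_matrix c).
Local Notation u := (@ord0 n.+2).
Local Notation v := (@ord_max n.+2).
Local Notation i1 := (lift ord0 ord0 : 'I_d).
Local Notation N := (d * (d - 1) - 1)%N.
Local Notation x := (\col_(i < d) 'X_i : 'cV[R]_d).
Local Notation Delta := (maximal_minor L).

Lemma signed_minorE i : signed_minor L i = Delta i.
Proof. by rewrite maximal_minorE. Qed.

Lemma linear_coef i j l : (L i j)@_(U_(l)) = c i j 0 l.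
Proof.
rewrite mxE raddf_sum (bigD1 l) //= mcoeffZ mcoeffX eqxx mulr1 big1 ?addr0 //.
by move=> k /negPf kl; rewrite mcoeffZ mcoeffXU kl mulr0.
Qed.

Lemma at_minorsX i : at_minors L 'X_i = Delta i.
Proof.
rewrite /at_minors comp_mpolyXU -tnth_nth tnth_mktuple.
exact: signed_minorE.
Qed.

Lemma PsiE j l : Psi L j l = \sum_i c i j 0 l *: Delta i.
Proof.
rewrite !mxE /at_minors rmorph_sum; apply: eq_bigr => i _ /=.
by rewrite comp_mpolyZ -/(at_minors L 'X_i) at_minorsX linear_coef.
Qed.

Lemma Psi_variables : Psi L *m x = 0.
Proof.
apply/matrixP => j o; rewrite [RHS]mxE mxE.
rewrite -[RHS](minors_syzygy L j).
under eq_bigr => l _ do rewrite PsiE mxE mulr_suml.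
rewrite exchange_big; apply: eq_bigr => i _; rewrite [L i j]mxE mulr_sumr.
by apply: eq_bigr => l _; rewrite -mpoly_scaleAl mpoly_scaleAr.
Qed.

Lemma cofactor_Psi j i : cofactor (Psi L) j i = at_minors L
  (basic_representative L j i).
Proof. exact: cofactor_map_mx. Qed.

Lemma linear_homog i j : L i j \is 1.-homog.
Proof.
by rewrite mxE; apply: rpred_sum => l _; apply: dhomogZ; rewrite dhomogX /=
  mdeg1.
Qed.

Lemma minor_homog i : Delta i \is d.-homog.
Proof.
rewrite maximal_minorE.
have -> : (-1 : R) ^+ i = ((-1) ^+ i)%:MP by rewrite rmorphXn /= mpolyCN
  mpolyC1.
rewrite mul_mpolyC; apply: dhomogZ; rewrite -[d in d.-homog]muln1.
by apply: dhomog_det => a b; rewrite !mxE; have := linear_homog (lift i a) b;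
  rewrite mxE.
Qed.

Lemma Psi_homog j l : Psi L j l \is d.-homog.
Proof.
by rewrite PsiE; apply: rpred_sum => i _; apply: dhomogZ; apply: minor_homog.
Qed.

Lemma line_restriction_Psi j l :
  line_restriction u v (Psi L j l) = line_jacobian c u v j l.
Proof.
rewrite PsiE rmorph_sum [RHS]mxE; apply: eq_bigr => i _.
by rewrite /= line_restrictionZ line_restriction_minor // mul_polyC.
Qed.

Lemma line_restriction_cofactor j i :
  line_restriction u v (cofactor (Psi L) j i) = cofactor (line_jacobian c u v) j
    i.
Proof.
rewrite -cofactor_map_mx; congr cofactor.
by apply/matrixP => a b; rewrite mxE; apply: line_restriction_Psi.
Qed.

Lemma cofactor_homog j i : cofactor (Psi L) j i \is (n.+2 * d).-homog.
Proof.
rewrite /cofactor.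
have -> : (-1 : R) ^+ (j + i) = ((-1) ^+ (j + i))%:MP.
  by rewrite rmorphXn /= mpolyCN mpolyC1.
rewrite mul_mpolyC; apply: dhomogZ; apply: dhomog_det => a b.
by rewrite [row' _ _ _ _]mxE [col' _ _ _ _]mxE; apply: Psi_homog.
Qed.

Variable D : 'I_d -> R.
Hypothesis DE : forall j i, cofactor (Psi L) j i = D j * 'X_i.

Lemma factor_homog j : D j \is N.-homog.
Proof.
apply: (@dhomog_divX _ _ _ _ ord0); rewrite mulrC -DE.
suff -> : N.+1 = (n.+2 * d)%N by apply: cofactor_homog.
by rewrite -[(d - 1)%N]/(n.+2) subn1 prednK 1?mulnC // muln_gt0.
Qed.

Lemma line_restriction_factor j : line_restriction u v (D j) = line_factor c u v
  j.
Proof.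
rewrite /line_factor -line_restriction_cofactor DE rmorphM /=.
by rewrite line_restrictionX /line_value eqxx mulr1.
Qed.

Lemma line_restriction_muni (p : R) :
  line_restriction u v p
    = map_poly (meval (fun i : 'I_n.+2 => (i == ord0)%:R)) (muni p).
Proof.
pose ev := meval (fun i : 'I_n.+2 => (i == ord0)%:R : K).
apply: (mpoly_rmorphism_ext (f := line_restriction u v)
  (g := map_poly ev \o @muni n.+2 K)) => [a|i].
  by rewrite [LHS]line_restrictionC /= muniC map_polyC /= /ev mevalC.
rewrite [LHS]line_restrictionX /line_value /=; case: (ord_max_or_widen i) =>
  [->|[j ->]].
  by rewrite muniX_max map_polyX eqxx.
rewrite muniX_widen map_polyC /= /ev mevalXU -[widen_ord _ j == ord_max]val_eqE
  /=.
rewrite -[widen_ord _ j == ord0]val_eqE -[j == ord0]val_eqE /=.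
case: eqP => // _; case: eqP => // jn; first by have := ltn_ord j; rewrite jn
  ltnn.
Qed.

Hypothesis coefs_unit : minor_coefs c u v \in unitmx.
Hypothesis line_neq0 : forall j, line_factor c u v j != 0.

Let p := line_factor c u v ord0 + line_factor c u v i1.
Let q := line_factor c u v i1.
Hypotheses (pN : p`_N != 0) (qN : q`_N != 0) (pq : resultant p q != 0).

Lemma factor_neq0 j : D j != 0.
Proof.
apply: contraNneq (line_neq0 j) => D0.
by rewrite -line_restriction_factor D0 rmorph0.
Qed.

Lemma lead_muni_line (g : R) : g \is N.-homog -> (line_restriction u v g)`_N !=
  0 ->
  size (muni g) = N.+1 /\
  lead_coef (muni g) = ((line_restriction u v g)`_N)%:MP.
Proof.
move=> hg gN; have [sg lg] := lead_muni_homog hg.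
have lgE : (muni g)`_N = ((line_restriction u v g)`_N)%:MP.
  by rewrite line_restriction_muni coef_map /= lg mevalC.
have sE : size (muni g) = N.+1.
  apply/eqP; rewrite eqn_leq sg ltnNge; apply/negP => /leq_sizeP/(_ N (leqnn
    _)).
  by rewrite lgE => /eqP; rewrite mpolyC_eq0 (negPf gN).
by split=> //; rewrite lead_coefE sE lgE.
Qed.

(** Elimination of the last variable from two combinations of the inversion
    factors; their resultant is nonzero because it is so on the line. *)
Lemma factors_regular : exists (e : {mpoly K[n.+2]}) (s : 'I_d -> R),
  [/\ e != 0, mwiden e = \sum_l s l * D l
    & lead_coef (muni (D i1)) \is a GRing.unit].
Proof.
pose G := D ord0 + D i1; pose H := D i1.
have hH : H \is N.-homog := factor_homog i1.
have hG : G \is N.-homog by apply: rpredD; apply: factor_homog.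
have lH : line_restriction u v H = q by rewrite line_restriction_factor.
have lG : line_restriction u v G = p by rewrite rmorphD /=
  !line_restriction_factor.
have [sG leadG] : size (muni G) = N.+1 /\ lead_coef (muni G) = (p`_N)%:MP.
  by rewrite -lG; apply: lead_muni_line; rewrite // lG.
have [sH leadH] : size (muni H) = N.+1 /\ lead_coef (muni H) = (q`_N)%:MP.
  by rewrite -lH; apply: lead_muni_line; rewrite // lH.
have N0 : (1 < N.+1)%N.
  by rewrite ltnS -[(d - 1)%N]/(n.+2) subn_gt0 mulnC mulSn addSn ltnS.
have sG1 : (1 < size (muni G))%N by rewrite sG.
have sH1 : (1 < size (muni H))%N by rewrite sH.
have [a [b resE]] := eliminate_last sG1 sH1.
exists (resultant (muni G) (muni H)).
exists (fun l => (l == ord0)%:R * a + (l == i1)%:R * (a + b)).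
split.
- apply: contraNneq pq => res0.
  pose ev := meval (fun i : 'I_n.+2 => (i == ord0)%:R : K).
  have fG : ev (lead_coef (muni G)) != 0 by rewrite leadG /ev mevalC.
  have fH : ev (lead_coef (muni H)) != 0 by rewrite leadH /ev mevalC.
  have pE : map_poly ev (muni G) = p := etrans (esym (line_restriction_muni _))
    lG.
  have qE : map_poly ev (muni H) = q := etrans (esym (line_restriction_muni _))
    lH.
  apply/eqP; rewrite -pE -qE -(map_resultant_rmorphism fG fH) res0.
  exact: meval0.
- rewrite resE /G /H; move: D => E.
  rewrite (bigD1 ord0) //= (bigD1 i1) //= big1 => [|l /andP[/negPf l0 /negPf
    l1]].
    by rewrite mul1r mul0r mul0r mul1r addr0 add0r addr0 mulrDr mulrDl addrA.
  by rewrite l0 l1 !mul0r addr0 mul0r.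
- rewrite leadH; apply/unitrP; exists (q`_N)^-1%:MP.
  by rewrite -!mpolyCM mulVf // mulfV.
Qed.

End OneMatrix.
(** ** The inverse map, the codimension and the resolution *)

Lemma mulr_swap_outer (A : comNzRingType) (a b c : A) : a * (b * c) = c * (b *
  a).
Proof. by rewrite mulrCA [RHS]mulrCA [a * c]mulrC. Qed.

Lemma at_minorsB (K : fieldType) d (L : 'M[{mpoly K[d]}]_(d.+1, d)) p q :
  at_minors L (p - q) = at_minors L p - at_minors L q.
Proof. exact: comp_mpolyB. Qed.

Lemma at_minorsM (K : fieldType) d (L : 'M[{mpoly K[d]}]_(d.+1, d)) p q :
  at_minors L (p * q) = at_minors L p * at_minors L q.
Proof. exact: rmorphM. Qed.

Lemma cofactor_in_ideal (A : comNzRingType) n (P : {pred A}) (M : 'M[A]_n.+2) i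
  j :
  idealr_closed P -> (forall k l, M k l \in P) -> cofactor M i j \in P.
Proof.
move=> iP MP; rewrite /cofactor (expand_det_row _ ord0); apply: (idealMl _ iP).
apply: (ideal_sum _ iP) => l _; rewrite mulrC; apply: (idealMl _ iP).
by rewrite !mxE.
Qed.

Section GoodMatrix.
Variables (K : fieldType) (n : nat).
Local Notation d := n.+3.
Local Notation R := {mpoly K[d]}.
Variable c : 'M['rV[K]_d]_(d.+1, d).
Local Notation L := (linear_matrix c).
Local Notation Delta := (maximal_minor L).
Local Notation N := (d * (d - 1) - 1)%N.
Local Notation x := (\col_(i < d) 'X_i : 'cV[R]_d).
Local Notation i1 := (lift ord0 ord0 : 'I_d).
Variable D : 'I_d -> R.
Hypothesis DE : forall j i, cofactor (Psi L) j i = D j * 'X_i.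
Hypothesis D_neq0 : forall j, D j != 0.
Hypothesis coefs_unit : minor_coefs c ord0 ord_max \in unitmx.

Let at_minors_basic j i : at_minors L (basic_representative L j i) = D j * 'X_i.
Proof. by rewrite -cofactor_Psi DE. Qed.

Lemma inversion_factors j : inversion_factor L (basic_representative L j) (D j).
Proof.
split; first by exists N; apply: (factor_homog DE).
exact: at_minors_basic.
Qed.

Lemma minor_scaled_variables (a : R) i :
  Delta i \mPo [tuple a * 'X_k | k < d] = a ^+ d * Delta i.
Proof.
pose f := comp_mpoly [tuple a * 'X_k | k < d] : {mpoly K[d]} -> R.
have fL : map_mx f L = a *: L.
  apply/matrixP => k l; rewrite mxE [RHS]mxE [L k l]mxE /f rmorph_sum mulr_sumr.
  apply: eq_bigr => m _ /=.
  by rewrite comp_mpolyZ comp_mpolyXU -tnth_nth tnth_mktuple mpoly_scaleAr.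
transitivity (maximal_minor (map_mx f L) i); first exact: (map_maximal_minor f L
  i).
by rewrite fL; apply: maximal_minorZ.
Qed.

Lemma at_minors_comp (p : R) (g : 'I_d -> {mpoly K[d.+1]}) :
  at_minors L (p \mPo [tuple g k | k < d])
    = p \mPo [tuple at_minors L (g k) | k < d].
Proof.
pose t := [tuple signed_minor L i | i < d.+1].
apply: (mpoly_rmorphism_ext
  (f := comp_mpoly t \o comp_mpoly [tuple g k | k < d])
  (g := comp_mpoly [tuple at_minors L (g k) | k < d])) => [a|k] /=.
  by rewrite !comp_mpolyC.
by rewrite !comp_mpolyXU -!tnth_nth !tnth_mktuple.
Qed.

Lemma exists_minor_neq0 : exists i, Delta i != 0.
Proof.
apply: boolp.contrapT => none.
suff c0 : minor_coefs c ord0 ord_max = 0.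
  by move: coefs_unit; rewrite c0 unitmxE det0 unitr0.
apply/matrixP => i k; rewrite !mxE -line_restriction_minor //.
case: (eqVneq (Delta i) 0) => [->|i0]; last by case: none; exists i.
by rewrite rmorph0 coef0.
Qed.

Lemma basic_homog j i : basic_representative L j i \is n.+2.-homog.
Proof.
rewrite /basic_representative /cofactor.
have -> : (-1 : {mpoly K[d.+1]}) ^+ (j + i) = ((-1) ^+ (j + i))%:MP.
  by rewrite rmorphXn /= mpolyCN mpolyC1.
rewrite mul_mpolyC; apply: dhomogZ.
suff : \det (row' j (col' i (jacobian_dual L))) \is (n.+2 * 1).-homog by rewrite
  muln1.
apply: dhomog_det => a b; rewrite !mxE.
by apply: rpred_sum => k _; apply: dhomogZ; rewrite dhomogX /= mdeg1.
Qed.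

(** On the minors the basic representative takes the value [D x], and the
    minors have degree [d]; so composing in the other order gives the minors
    multiplied by [D ^ d]. *)
Lemma basic_inverse j : inverse_representative L (basic_representative L j).
Proof.
have DgE i : at_minors L (signed_minor L i \mPo [tuple basic_representative L j
  k | k < d])
    = D j ^+ d * Delta i.
  rewrite at_minors_comp signed_minorE -minor_scaled_variables; congr (_ \mPo
    _).
  by apply: eq_from_tnth => k; rewrite !tnth_mktuple at_minors_basic.
split.
- by exists n.+2; apply: basic_homog.
- exists ord0; rewrite /image_ideal at_minors_basic => /eqP.
  by rewrite mulf_eq0 (negPf (D_neq0 j)) (negPf (mpolyX_neq0 _ _)).
- move=> i k; apply: (etrans (congr1 ( *%R 'X_i) (at_minors_basic j k))).
  apply: (etrans _ (esym (congr1 ( *%R 'X_k) (at_minors_basic j i)))).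
  exact: mulr_swap_outer.
- have [i Di] := exists_minor_neq0; exists i; rewrite /image_ideal DgE => /eqP.
  by rewrite mulf_eq0 expf_eq0 (negPf (D_neq0 j)) andbF (negPf Di).
- have XDg i k := etrans (at_minorsM L 'X_i _)
    (congr2 *%R (at_minorsX c i) (DgE k)).
  move=> i k; apply: (etrans (at_minorsB _ _ _)).
  apply: (etrans (congr2 (fun p q => p - q) (XDg i k) (XDg k i))).
  move: (Delta i) (Delta k) (D j ^+ d) => X Y Z.
  by rewrite mulr_swap_outer subrr.
Qed.

Variables (e : {mpoly K[n.+2]}) (s : 'I_d -> R).
Hypotheses (e_neq0 : e != 0) (eE : mwiden e = \sum_l s l * D l).
Hypothesis D_monic : lead_coef (muni (D i1)) \is a GRing.unit.

Let ideal_genD l : ideal_gen D (D l).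
Proof.
exists (fun k => (k == l)%:R); rewrite (bigD1 l) //= eqxx mul1r big1 ?addr0 //.
by move=> k /negPf->; rewrite mul0r.
Qed.

(** A prime over the minors that misses some variable [X] contains the
    inversion factors, because it contains the cofactors [D X]. *)
Lemma factors_codim : has_codim (ideal_gen D) 2.
Proof.
split=> [P Pprime IP|].
  apply: (height_ge2 Pprime e_neq0 _ (IP _ (ideal_genD i1)) D_monic).
  by apply: IP; exists s; rewrite eE.
have [P [Pprime DP XP hP]] := minors_prime coefs_unit; exists P; split=> //.
have [iP pP] := Pprime.
have PsiP j l : Psi L j l \in P.
  rewrite PsiE; apply: (ideal_sum _ iP) => i _.
  by rewrite -mul_mpolyC; apply: (idealMl _ iP).
have DjP j : D j \in P.
  have : D j * 'X_(lift ord0 (widen_ord (leqnSn _) (@ord0 n))) \in P.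
    by rewrite -DE; apply: (cofactor_in_ideal _ _ iP).
  by move/pP; rewrite (negPf (XP ord0)) orbF.
move=> f [a ->]; apply: (ideal_sum _ iP) => j _; exact: (idealMl _ iP).
Qed.

Lemma degree_factor : (N.+1 = n.+2 * d)%N.
Proof. by rewrite -[(d - 1)%N]/(n.+2) subn1 prednK 1?mulnC // muln_gt0. Qed.

Lemma factors_resolution :
  minimal_graded_free_resolution3 (ideal_gen D)
    (fun _ : 'I_d => N) (fun _ : 'I_d => (d ^ 2 - 1)%N) (fun _ : 'I_1 => (d ^
      2)%N)
    (\row_j D j) (Psi L) x.
Proof.
have Dh j := factor_homog DE j.
have d2 : (d ^ 2 - 1 = N + d)%N.
  apply: succn_inj; rewrite -addSn degree_factor subn1 prednK ?expn_gt0 //.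
  by rewrite -mulSnr.
have X0 i : ('X_i : R)@_0%MM = 0 by rewrite mcoeffX mnm1_eq0.
have N0 : (0 < N)%N by rewrite -ltnS degree_factor mulSn addSn ltnS.
split; [split|split; [split|split]].
- by move=> i j; rewrite /= mxE subn0.
- by move=> i j; rewrite d2 leq_addr addKn; apply: Psi_homog.
- move=> i j; rewrite leq_subr mxE subKn ?expn_gt0 // dhomogX /= mdeg1 //.
- move=> i j; rewrite mxE; apply: (dhomog_nemf_coeff (Dh j)).
  by rewrite /= mdeg0 eq_sym -lt0n.
- by move=> i j; apply: (dhomog_nemf_coeff (Psi_homog c i j)); rewrite /= mdeg0.
- by move=> i j; rewrite mxE.
- move=> f; split=> [[a ->]|[v fv]].
    exists (\col_j a j); apply/matrixP => o o'; rewrite !ord1 !mxE eqxx mulr1n.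
    by apply: eq_bigr => j _; rewrite !mxE mulrC.
  exists (fun j => v j 0); move/matrixP/(_ 0 0): fv; rewrite !mxE eqxx mulr1n =>
    ->.
  by apply: eq_bigr => j _; rewrite !mxE mulrC.
- move=> v; split=> [Dv|[w ->]].
    exact: (syzygies_factors (Psi_variables c) DE D_neq0 e_neq0 eE D_monic Dv).
  by rewrite mulmxA (row_factors_mul (Psi_variables c) DE) mul0mx.
- move=> w; split=> [Pw|[h ->]].
    have [h hE] := kernel_variables (Psi_variables c) DE D_neq0 Pw.
    by exists h%:M.
  by rewrite mulmxA Psi_variables mul0mx.
- move=> w /matrixP/(_ ord0 0); rewrite !mxE big_ord1 mxE => /eqP.
  rewrite mulf_eq0 (negPf (mpolyX_neq0 _ _)) /= => /eqP w0.
  by apply/matrixP => i j; rewrite !ord1 w0 mxE.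
Qed.

End GoodMatrix.

(** The first condition bounds the codimension from above, the second makes the
    basic representatives nonzero on the image, and the third bounds the
    codimension from below. *)
Record line_general (K : fieldType) n (c : 'M['rV[K]_n.+3]_(n.+4, n.+3)) : Prop
  :=
  LineGeneral {
    _ : minor_coefs c ord0 ord_max \in unitmx;
    _ : forall j, line_factor c ord0 ord_max j != 0;
    _ : let N := (n.+3 * (n.+3 - 1) - 1)%N in
        let q := line_factor c ord0 ord_max (lift ord0 ord0) in
        let p := line_factor c ord0 ord_max ord0 + q in
        [/\ p`_N != 0, q`_N != 0 & resultant p q != 0]
  }.

Theorem line_general_resolution (K : fieldType) n (c : 'M['rV[K]_n.+3]_(n.+4,
  n.+3)) :
  let d := n.+3 in let L := linear_matrix c in line_general c ->
  homaloidal_like L /\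
  (forall j : 'I_d, inverse_representative L (basic_representative L j)) /\
  exists D : 'I_d -> {mpoly K[d]},
    [/\ forall j, inversion_factor L (basic_representative L j) (D j),
        has_codim (ideal_gen D) 2
      & minimal_graded_free_resolution3 (ideal_gen D)
          (fun _ : 'I_d => (d * (d - 1) - 1)%N)
          (fun _ : 'I_d => (d ^ 2 - 1)%N)
          (fun _ : 'I_1 => (d ^ 2)%N)
          (\row_j D j) (Psi L) (\col_(i < d) 'X_i)].
Proof.
move=> d L [coefs_unit line0 [pN qN pq]].
have /fin_all_exists[D DE] j := cofactors_variables j (Psi_variables c).
have D0 := factor_neq0 DE line0.
have inv := basic_inverse DE D0 coefs_unit.
have [e [s [e0 eE Dm]]] := factors_regular DE pN qN pq.
split; first by exists (basic_representative L ord0).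
split=> //; exists D; split; first exact: inversion_factors.
- exact: (factors_codim DE coefs_unit e0 eE Dm).
- exact: (factors_resolution DE D0 e0 eE Dm).
Qed.

(** * A matrix with good restriction to a line *)

Section Example.
Variables (K : fieldType) (n : nat).
Local Notation d := n.+3.
Local Notation u := (@ord0 n.+2).
Local Notation v := (@ord_max n.+2).
Local Notation i1 := (lift ord0 ord0 : 'I_d).

(** On the line the matrix is the pencil whose minors are, up to sign, the
    powers of the coordinate; the other variables are placed so that the
    Jacobian dual becomes bidiagonal outside the columns of [u] and [v]. *)
Definition bidiagonal_coefs : 'M['rV[K]_d]_(d.+1, d) :=
  \matrix_(i, j) \row_l
    (if l == u then (i == j :> nat)%:R
     else if l == v then - (i == j.+1 :> nat)%:R
     else (i == d :> nat)%:R * (j == l)%:R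
          + (i == 0 :> nat)%:R * (j == l.+1 :> nat)%:R).

Local Notation c := bidiagonal_coefs.
Local Notation s := ((-1) ^+ d : {poly K}).
Local Notation Dl := (maximal_minor (line_matrix c u v)).
Local Notation J := (line_jacobian c u v).
Local Notation f := (line_factor c u v).

Let lmE i j : line_matrix c u v i j
  = (i == j :> nat)%:R - (i == j.+1 :> nat)%:R * 'X.
Proof.
rewrite !mxE -[v == u]/false !eqxx polyC_natr; congr (_ + _).
by rewrite -mul_polyC polyCN polyC_natr mulNr.
Qed.

Let sum_delta (g : 'I_d.+1 -> {poly K}) (j : 'I_d.+1) :
  \sum_i g i * (i == j :> nat)%:R = g j.
Proof.
rewrite (bigD1 j) //= eqxx mulr1 big1 ?addr0 // => i.
by rewrite -val_eqE => /negPf->; rewrite mulr0.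
Qed.

Let line_minor_step (j : 'I_d) : Dl (widen_ord (leqnSn d) j) = 'X * Dl (lift
  ord0 j).
Proof.
have := minors_syzygy (line_matrix c u v) j.
under eq_bigr => i _ do rewrite lmE mulrBr mulrA.
rewrite sumrB -mulr_suml (sum_delta _ (widen_ord (leqnSn d) j)).
rewrite (sum_delta _ (lift ord0 j)) mulrC => /eqP.
by rewrite subr_eq0 => /eqP.
Qed.

Lemma bidiagonal_line_minor i : Dl i = s * 'X^(d - i).
Proof.
have [m] : exists m, (d - i = m)%N by exists (d - i)%N.
elim: m i => [|m IH] i im.
  (* Without its last row the pencil is lower triangular, with diagonal one. *)
  have -> : i = ord_max.
    apply/val_inj/eqP; rewrite /= eqn_leq -ltnS ltn_ord /= -subn_eq0.
    by rewrite im.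
  have liftE (a : 'I_d) : lift ord_max a = widen_ord (leqnSn d) a.
    by apply/val_inj; rewrite /= /bump leqNgt ltn_ord.
  rewrite maximal_minorE subnn expr0; congr (_ * _); rewrite det_trig.
    rewrite big1 // => a _; rewrite mxE lmE liftE /= eqxx ltn_eqF //.
    by rewrite mul0r subr0.
  apply/is_trig_mxP => a b ab; rewrite mxE lmE liftE /=.
  by rewrite ltn_eqF // ltn_eqF ?mul0r ?subr0 // leqW.
have id : (i < d)%N by rewrite -subn_gt0 im.
have -> : i = widen_ord (leqnSn d) (Ordinal id) by apply/val_inj.
rewrite line_minor_step IH /=; last by rewrite /bump /= add1n subnS im.
by rewrite /bump /= add1n mulrCA -exprS -subSn.
Qed.

Let JE j l : J j l = s *
  (if l == u then 'X^(d - j)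
   else if l == v then - 'X^(d - j.+1)
   else (j == l)%:R + (j == l.+1 :> nat)%:R * 'X^d).
Proof.
rewrite mxE; under eq_bigr => i _ do rewrite !mxE bidiagonal_line_minor.
case: (l == u).
  under eq_bigr => i _ do rewrite polyC_natr mulrC.
  by rewrite (sum_delta _ (widen_ord (leqnSn d) j)).
case: (l == v).
  under eq_bigr => i _ do rewrite polyCN polyC_natr mulrC mulrN.
  by rewrite sumrN (sum_delta _ (lift ord0 j)) mulrN.
under eq_bigr => i _ do rewrite polyCD !polyCM !polyC_natr mulrC mulrDr !(mulrA
  (s * _)).
rewrite big_split /= -!mulr_suml mulrDr.
rewrite (sum_delta (fun i => s * 'X^(d - i)) ord_max).
rewrite (sum_delta (fun i => s * 'X^(d - i)) ord0) /= subnn subn0 expr0 mulr1.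
by congr (_ + _); rewrite -mulrA; congr (_ * _); apply: mulrC.
Qed.

Let kernelJ : J *m (\col_l (if l == u then 1 else if l == v then 'X else 0)) =
  0.
Proof.
apply/matrixP => j o; rewrite [RHS]mxE mxE (bigD1 u) //= (bigD1 v) //= big1.
  rewrite addr0 !JE !mxE -[v == u]/false !eqxx mulr1.
  have -> : (d - j = (d - j.+1).+1)%N by rewrite subnSK.
  by rewrite (exprSr 'X) mulrA mulrN mulNr subrr.
by move=> l /andP[/negPf lu /negPf lv]; rewrite JE !mxE lu lv mulr0.
Qed.

Let detJ : \det J = 0.
Proof. by apply: (det_kernel0 (l := u)) kernelJ _; rewrite mxE eqxx oner_neq0.
  Qed.

Let cofactor_last j : cofactor J j v = 'X * f j.
Proof.
by have := cofactor_kernel j u v detJ kernelJ; rewrite !mxE -[v == u]/false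
  !eqxx mul1r.
Qed.

Let factor_relation l : \sum_j f j * J j l = 0.
Proof.
have /matrixP/(_ u l) := mul_adj_mx J; rewrite detJ [RHS]mxE mul0rn => adjJ.
by rewrite -[RHS]adjJ [RHS]mxE; apply: eq_bigr => j _; rewrite [\adj _ _ _]mxE.
Qed.

Let polyX_neq0 : 'X != 0 :> {poly K}.
Proof. by rewrite polyX_eq0. Qed.

Let s_neq0 m : (-1 : {poly K}) ^+ m != 0.
Proof. by rewrite signr_eq0. Qed.

Local Notation sg := ((-1) ^+ (d * n.+2) : {poly K}).

Let factor_last : f v = sg * 'X^(n.+2).
Proof.
apply: (mulfI polyX_neq0); rewrite -cofactor_last /cofactor -signr_odd oddD
  addbb mul1r.
have liftE (a : 'I_n.+2) : lift v a = widen_ord (leqnSn _) a.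
  by apply/val_inj; rewrite /= /bump leqNgt ltn_ord.
have lv (a : 'I_n.+2) : (widen_ord (leqnSn n.+2) a == v) = false.
  by apply/eqP => /(congr1 val) /= av; have := ltn_ord a; rewrite av ltnn.
have JlE (a b : 'I_n.+2) : row' v (col' v J) a b = J (widen_ord (leqnSn _) a)
  (widen_ord (leqnSn _) b).
  by rewrite [LHS]mxE [LHS]mxE !liftE.
(* Without column [v] and the last row the rest is lower triangular. *)
rewrite det_trig; last first.
  apply/is_trig_mxP => a b ab; rewrite JlE JE lv -val_eqE /=.
  have -> : (b == 0 :> nat) = false by case: (val b) ab.
  by rewrite -val_eqE /= !ltn_eqF ?mul0r ?addr0 ?mulr0 // leqW.
rewrite big_ord_recl JlE JE -val_eqE /= subn0.
rewrite (eq_bigr (fun=> s)) => [|a _]; last first.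
  rewrite JlE JE lv -val_eqE /= eqxx.
  by rewrite ltn_eqF ?mul0r ?addr0 ?mulr1.
rewrite big_const card_ord iter_mulr_1 mulrAC -(exprS s) exprM.
by rewrite [RHS]mulrCA -(exprS 'X).
Qed.

Let factor_step (l : 'I_n.+2) : (0 < l)%N ->
  f (widen_ord (leqnSn _) l) = - 'X^d * f (lift ord0 l).
Proof.
move=> l0; have := factor_relation (widen_ord (leqnSn _) l).
have lu : (widen_ord (leqnSn n.+2) l == u) = false.
  by rewrite -val_eqE /= eqn0Ngt l0.
have lv : (widen_ord (leqnSn n.+2) l == v) = false.
  by apply/eqP => /(congr1 val) /= av; have := ltn_ord l; rewrite av ltnn.
under eq_bigr => j _ do rewrite JE lu lv mulrCA mulrDr.
rewrite -mulr_sumr => /eqP; rewrite mulf_eq0 (negPf (s_neq0 _)) /= big_split /=.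
rewrite (bigD1 (widen_ord (leqnSn _) l)) //= eqxx mulr1 big1 => [|j /negPf->];
  last by rewrite mulr0.
rewrite (bigD1 (lift ord0 l)) //= eqxx mul1r big1 => [|j jl]; last first.
  by rewrite (_ : (j == l.+1 :> nat) = false) ?mul0r ?mulr0 //; apply: contraNF
    jl; rewrite -val_eqE.
by rewrite !addr0 addr_eq0 mulNr mulrC => /eqP.
Qed.

Let factor_power i (l : 'I_d) : (0 < l)%N -> (l + i = n.+2)%N ->
  f l = sg * (- 'X^d) ^+ i * 'X^(n.+2).
Proof.
elim: i l => [|i IH] l l0 li.
  rewrite expr0 mulr1 -factor_last; congr (line_factor _ _ _ _); apply/val_inj.
  by move: li; rewrite addn0.
have ln : (l < l + i.+1)%N by rewrite addnS ltnS leq_addr.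
rewrite li in ln.
have -> : l = widen_ord (leqnSn _) (Ordinal ln) by apply/val_inj.
rewrite factor_step // IH //.
  have -> : (- 'X^d) ^+ i.+1 = - 'X^d * (- 'X^d) ^+ i :> {poly K} by apply:
    exprS.
  by move: sg (- 'X^d) => b e; rewrite !mulrA [e * b]mulrC.
by rewrite /= /bump /= add1n addSnnS.
Qed.

Local Notation H := (\sum_(i < n.+2) (- 'X^(d.+1)) ^+ i : {poly K}).

Let factor_first : f u = - (sg * H).
Proof.
apply: (mulfI (expf_neq0 d polyX_neq0)); have := factor_relation u.
under eq_bigr => j _ do rewrite JE eqxx mulrCA.
rewrite -mulr_sumr => /eqP; rewrite mulf_eq0 (negPf (s_neq0 _)) /= big_ord_recl
  /= subn0.
rewrite addr_eq0 mulrC => /eqP->; rewrite mulrN; congr (- _).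
(* Number the factors from the last one, as in [factor_power]. *)
rewrite (reindex_inj rev_ord_inj) /= mulrCA !mulr_sumr; apply: eq_bigr => i _.
have ilt := ltn_ord i.
rewrite (@factor_power i); last 2 first.
- by rewrite /= /bump.
- by rewrite /= /bump /= add1n addSnnS subnK.
rewrite /bump /= add1n subSS.
have -> : (n.+2 - (n.+2 - i.+1) = i.+1)%N by rewrite subKn.
have -> : - 'X^(d.+1) = (- 'X^d) * 'X :> {poly K} by rewrite (exprSr 'X d)
  mulNr.
have XE : 'X^(n.+2) * 'X^(i.+1) = 'X^d * 'X^i :> {poly K}.
  by rewrite -!exprD addnS addSn.
move: (d * n.+2)%N => m; rewrite exprMn; move: ((- 'X^d) ^+ i) => a.
move: 'X^(n.+2) 'X^(i.+1) 'X^d 'X^i XE => b e g h XE.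
by rewrite -!mulrA XE [a * _]mulrCA.
Qed.

Let H0 : H.[0] = 1.
Proof.
rewrite horner_sum big_ord_recl big1 => [|i _]; first by rewrite expr0 hornerC
  addr0.
by rewrite horner_exp hornerN hornerXn expr0n /= oppr0 expr0n.
Qed.

Lemma bidiagonal_line_general : line_general c.
Proof.
have sgE m : (-1 : {poly K}) ^+ m = ((-1) ^+ m)%:P by rewrite rmorph_sign.
have qE : f i1 = (-1) ^+ (d * n.+2 + n.+1) * 'X^(n.+3 * (n.+3 - 1) - 1).
  rewrite (@factor_power n.+1) //.
  have NX : (- 'X^d) ^+ n.+1 = (-1) ^+ n.+1 * 'X^(d * n.+1) :> {poly K}.
    by rewrite [LHS]exprNn exprM.
  have XN : 'X^(d * n.+1) * 'X^(n.+2) = 'X^(n.+3 * (n.+3 - 1) - 1) :> {poly K}.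
    rewrite -exprD; congr ('X^_); apply: succn_inj.
    by rewrite degree_factor -addnS mulnC -mulSnr.
  rewrite NX exprD -XN; move: 'X^(d * n.+1) 'X^(n.+2) => a b.
  by rewrite !mulrA.
split.
- have MM : minor_coefs c u v *m minor_coefs c u v = 1%:M.
    have mcE i k : minor_coefs c u v i k = (-1) ^+ d * (k == (d - i)%N :>
      nat)%:R.
      by rewrite mxE bidiagonal_line_minor sgE coefCM coefXn.
    apply/matrixP => i k; rewrite !mxE.
    under eq_bigr => j _ do rewrite !mcE mulrACA -expr2 sqrr_sign mul1r.
    rewrite (bigD1 (rev_ord i)) //= subSS eqxx mul1r big1 ?addr0 => [|j ji].
      rewrite subKn; first by rewrite eq_sym.
      by rewrite -ltnS ltn_ord.
    rewrite (_ : (j == (d - i)%N :> nat) = false) ?mul0r //; apply: contraNF ji.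
    by rewrite -val_eqE /= subSS.
  by case: (mulmx1_unit MM).
- move=> j; have [j0|j0] := posnP j.
    have -> : j = u by apply/val_inj.
    rewrite factor_first oppr_eq0 mulf_neq0 //.
    by apply: contra_neq (oner_neq0 K) => H00; rewrite -H0 H00 horner0.
  rewrite (@factor_power (n.+2 - j) j) //; last by rewrite subnKC // -ltnS.
  apply: mulf_neq0; last exact: expf_neq0.
  apply: mulf_neq0; first exact: s_neq0.
  by apply: expf_neq0; rewrite oppr_eq0; apply: expf_neq0.
move=> N q p; have qN : q`_N != 0.
  by rewrite /q qE sgE coefCM coefXn eqxx mulr1 signr_eq0.
have pN : p`_N = q`_N.
  rewrite /p coefD factor_first coefN sgE coefCM coef_sum big1 ?mulr0 ?oppr0
    ?add0r //.
  move=> i _; rewrite [(- _) ^+ i]exprNn -exprM sgE coefCM coefXn.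
  suff /gtn_eqF-> : (d.+1 * i < N)%N by rewrite mulr0.
  apply: (@leq_ltn_trans (d.+1 * n.+1)); first by rewrite leq_mul2l -ltnS
    ltn_ord orbT.
  rewrite -ltnS degree_factor [(n.+2 * _)%N]mulSn mulnC mulnS -addSn.
  by rewrite ltn_add2r.
split; rewrite ?pN // resultant_eq0 -leqNgt.
(* [q] is a signed power of the coordinate; [p] is nonzero at the origin. *)
suff : coprimep p q by rewrite /coprimep => /eqP->.
rewrite (qE : q = _) sgE mul_polyC coprimepZr ?signr_eq0 //; apply:
  coprimep_expr.
rewrite -['X]subr0 -polyC0 coprimep_XsubC /root /p hornerD factor_first hornerN.
rewrite sgE hornerM hornerC H0 mulr1 /q qE sgE hornerM hornerC hornerXn.
have N0 : (N == 0)%N = false.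
  apply/eqP => N0; have : N.+1 = (n.+2 * d)%N := degree_factor n.
  by rewrite N0 mulSn addSn.
by rewrite expr0n N0 mulr0 addr0 oppr_eq0 signr_eq0.
Qed.

End Example.

(** * The general matrix *)

(** ** The conditions are polynomial in the coefficients *)

Section Naturality.
Variables (A B : comNzRingType) (f : {rmorphism A -> B}).
Variables (d : nat) (c : 'M['rV[A]_d]_(d.+1, d)) (u v : 'I_d).
Local Notation fc := (map_mx (map_mx f) c).

Lemma map_line_matrix : line_matrix fc u v = map_mx (map_poly f) (line_matrix c
  u v).
Proof.
apply/matrixP => i j; rewrite !mxE rmorphD /= map_polyC /=.
by rewrite map_polyZ map_polyX.
Qed.

Lemma map_line_minor i :
  maximal_minor (line_matrix fc u v) i = map_poly f (maximal_minor (line_matrix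
    c u v) i).
Proof. by rewrite map_line_matrix map_maximal_minor. Qed.

Lemma map_minor_coefs : minor_coefs fc u v = map_mx f (minor_coefs c u v).
Proof. by apply/matrixP => i k; rewrite !mxE map_line_minor coef_map. Qed.

Lemma map_line_factor j : line_factor fc u v j = map_poly f (line_factor c u v
  j).
Proof.
rewrite /line_factor -cofactor_map_mx; congr cofactor.
apply/matrixP => i l; rewrite !mxE rmorph_sum; apply: eq_bigr => m _.
by rewrite rmorphM /= map_line_minor map_polyC !mxE.
Qed.

End Naturality.

Lemma size_line_factor (K : fieldType) n (c : 'M['rV[K]_n.+3]_(n.+4, n.+3)) j :
  (size (line_factor c ord0 ord_max j) <= (n.+3 * (n.+3 - 1) - 1).+1)%N.
Proof.
have /fin_all_exists[D DE] l := cofactors_variables l (Psi_variables c).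
rewrite -(line_restriction_factor DE); apply/leq_sizeP => k Nk.
by rewrite (coef_line_restriction _ _ (factor_homog DE j)) // leqNgt Nk.
Qed.

Section Generic.
Variables (k : fieldType) (d : nat).
Local Notation index := ('I_d.+1 * 'I_d * 'I_d)%type.
Local Notation cpoly := {mpoly k[#|{: index}|]}.

Definition generic_coefs : 'M['rV[cpoly]_d]_(d.+1, d) :=
  \matrix_(i, j) \row_l 'X_(enum_rank (i, j, l)).

Section Evaluation.
Variables (K : fieldType) (iota : {rmorphism k -> K}) (c : 'M['rV[K]_d]_(d.+1,
  d)).

Definition coef_eval (f : cpoly) : K := (map_mpoly iota f).@[coef_value c].

HB.instance Definition _ :=
  GRing.RMorphism.copy coef_eval (meval (coef_value c) \o map_mpoly iota).

Lemma coef_evalC a : coef_eval a%:MP = iota a.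
Proof. by rewrite /coef_eval map_mpolyC mevalC. Qed.

Lemma coef_evalX w : coef_eval 'X_w = coef_value c w.
Proof. by rewrite /coef_eval map_mpolyX mevalXU. Qed.

Lemma coef_value_rank i j l : coef_value c (enum_rank (i, j, l)) = c i j 0 l.
Proof. by rewrite /coef_value enum_rankK. Qed.

Lemma coef_eval_generic : map_mx (map_mx coef_eval) generic_coefs = c.
Proof.
apply/matrixP => i j; apply/rowP => l.
by rewrite !mxE coef_evalX coef_value_rank.
Qed.

End Evaluation.

(** ** The generic point *)

Local Notation F := {fraction cpoly}.

Definition generic_iota : {rmorphism k -> F} := (@tofrac cpoly) \o (@mpolyC _
  k).

Definition generic_point : 'M['rV[F]_d]_(d.+1, d) :=
  map_mx (map_mx (@tofrac cpoly)) generic_coefs.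

Lemma coef_eval_generic_point f : coef_eval generic_iota generic_point f =
  tofrac f.
Proof.
apply: (mpoly_rmorphism_ext (f := coef_eval generic_iota generic_point)
  (g := @tofrac cpoly)) => [a|w] /=.
  by rewrite coef_evalC.
rewrite coef_evalX -[w]enum_valK; case: (enum_val w) => [[i j] l].
by rewrite coef_value_rank !mxE.
Qed.

Hypothesis d_gt0 : (0 < d)%N.

Lemma generic_coordinates : coordinates generic_point.
Proof.
move=> i j; apply/rV0Pn; exists (Ordinal d_gt0).
by rewrite !mxE tofrac_eq0 mpolyX_neq0.
Qed.

(** The generic point lies in every nonempty open set. *)
Lemma nonvanishing_dense (H : cpoly -> Prop) (U : pointset k d) f :
  f != 0 ->
  (forall (K : fieldType) (iota : {rmorphism k -> K}) c,
     coordinates c -> coef_eval iota c f != 0 -> U K iota c) ->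
  zariski_dense H U.
Proof.
move=> f0 fU V [S _ VE] [K [iota [c /VE[_ [g Sg gc]]]]].
have g0 : g != 0.
  by apply: contraNneq gc => ->; rewrite -/(coef_eval iota c 0) rmorph0.
exists F, generic_iota, generic_point; split.
  apply: fU; first exact: generic_coordinates.
  by rewrite coef_eval_generic_point tofrac_eq0.
apply/VE; split; first exact: generic_coordinates.
by exists g => //; rewrite -/(coef_eval _ _ g) coef_eval_generic_point
  tofrac_eq0.
Qed.

(** ** Scaling the entries independently *)

Definition entry_of (w : 'I_#|{: index}|) : 'I_d.+1 * 'I_d := (enum_val w).1.

Local Notation entries := ('I_d.+1 * 'I_d)%type.

Definition multidegree (m : 'X_{1..#|{: index}|}) : 'X_{1..#|{: entries}|} :=
  (\sum_w U_(enum_rank (entry_of w)) *+ m w)%MM.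

Definition multidegree_part (f : cpoly) (e : 'X_{1..#|{: entries}|}) : cpoly :=
  \sum_(m <- msupp f | multidegree m == e) f@_m *: 'X_[m].

Lemma mcoeff_multidegree_part f e m :
  (multidegree_part f e)@_m = if multidegree m == e then f@_m else 0.
Proof.
rewrite /multidegree_part raddf_sum /= big_mkcond [in RHS](mpolyE f).
rewrite raddf_sum /=; case: ifP => me.
  apply: eq_bigr => m' _; case: ifP => // m'e; rewrite mcoeffZ mcoeffX.
  by case: eqP => [mm|]; [rewrite mm me in m'e|rewrite mulr0].
apply: big1 => m' _; case: ifP => // m'e; rewrite mcoeffZ mcoeffX.
by case: eqP => [mm|]; [rewrite mm me in m'e|rewrite mulr0].
Qed.

Lemma multidegreeE m i j :
  multidegree m (enum_rank (i, j)) = (\sum_(l < d) m (enum_rank (i, j, l)))%N.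
Proof.
rewrite /multidegree mnm_sumE.
under eq_bigr => w _ do rewrite mulmnE mnm1E (inj_eq enum_rank_inj).
rewrite (reindex_onto (@enum_rank index) (@enum_val index predT)) /=; last
  first.
  by move=> w _; rewrite enum_valK.
transitivity (\sum_(p : index) (p.1 == (i, j)) * m (enum_rank (p.1, p.2)))%N.
  apply: eq_big => [p|[[a b] l] _]; first by rewrite enum_rankK eqxx.
  by rewrite /entry_of enum_rankK.
rewrite -(pair_bigA _ (fun a l => (a == (i, j)) * m (enum_rank (a, l)))%N) /=.
rewrite (bigD1 (i, j)) //= [X in (_ + X)%N]big1 ?addn0 => [|a /negPf aij].
  by apply: eq_bigr => l _; rewrite eqxx mul1n.
by rewrite big1 // => l _; rewrite aij mul0n.
Qed.

Lemma multidegree_part_multihomogeneous f e : multihomogeneous (multidegree_part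
  f e).
Proof.
move=> i j; exists (e (enum_rank (i, j))) => m; rewrite mcoeff_msupp.
rewrite mcoeff_multidegree_part -multidegreeE.
by case: (multidegree m =P e) => [->//|]; rewrite eqxx.
Qed.

(** Scale the entries by independent variables: the multihomogeneous parts of
    [f] become the coefficients of the monomials in the scaling variables. *)
Section Scaling.
Variables (K : fieldType) (iota : {rmorphism k -> K}) (c : 'M['rV[K]_d]_(d.+1,
  d)).
Local Notation A := {mpoly K[#|{: entries}|]}.
Local Notation G := {fraction A}.

Definition scaling_tau : {rmorphism K -> G} := (@tofrac A) \o (@mpolyC _ K).

Definition scaled_coefs : 'M['rV[G]_d]_(d.+1, d) :=
  \matrix_(i, j) (tofrac 'X_(enum_rank (i, j)) *: map_mx scaling_tau (c i j)).

Lemma scaled_same_point : same_point (map_mx (map_mx scaling_tau) c)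
  scaled_coefs.
Proof.
move=> i j; exists (tofrac 'X_(enum_rank (i, j))); first by rewrite tofrac_eq0
  mpolyX_neq0.
by rewrite !mxE.
Qed.

Lemma scaled_coordinates : coordinates c -> coordinates scaled_coefs.
Proof.
move=> cc i j; have /rV0Pn[l cl] := cc i j; apply/rV0Pn; exists l.
by rewrite !mxE mulf_neq0 // ?tofrac_eq0 ?mpolyX_neq0 // mpolyC_eq0.
Qed.

Definition scaled_value : cpoly -> A :=
  mmap (@mpolyC _ K \o iota)
    (fun w => coef_value c w *: 'X_(enum_rank (entry_of w))).

HB.instance Definition _ :=
  GRing.RMorphism.copy scaled_value (mmap (@mpolyC _ K \o iota)
    (fun w => coef_value c w *: 'X_(enum_rank (entry_of w)))).

Lemma coef_eval_scaled f :
  coef_eval (scaling_tau \o iota) scaled_coefs f = tofrac (scaled_value f).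
Proof.
apply: (mpoly_rmorphism_ext (f := coef_eval (scaling_tau \o iota) scaled_coefs)
  (g := @tofrac A \o scaled_value)) => [a|w].
  by rewrite [LHS]coef_evalC /= /scaled_value mmapC.
rewrite [LHS]coef_evalX /= /scaled_value mmapX mmap1U.
rewrite -[w]enum_valK /entry_of enum_rankK; case: (enum_val w) => [[i j] l].
by rewrite !coef_value_rank !mxE /= -mul_mpolyC rmorphM mulrC.
Qed.

Lemma mcoeff_scaled_value f e :
  (scaled_value f)@_e = coef_eval iota c (multidegree_part f e).
Proof.
rewrite /multidegree_part rmorph_sum big_mkcond /= /scaled_value /mmap raddf_sum
  /=.
apply: eq_bigr => m _; rewrite mul_mpolyC mcoeffZ.
have -> : mmap1 (fun w => coef_value c w *: 'X_(enum_rank (entry_of w))) m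
    = (\prod_w coef_value c w ^+ m w) *: 'X_[multidegree m] :> A.
  rewrite /mmap1 /multidegree -mprodXnE -scaler_prod.
  by apply: eq_bigr => w _; rewrite exprZn.
rewrite mcoeffZ mcoeffX; case: eqP => _; last by rewrite !mulr0.
rewrite mulr1 -mul_mpolyC rmorphM /= coef_evalC; congr (_ * _).
by rewrite /coef_eval map_mpolyX mevalX.
Qed.

End Scaling.

End Generic.

(** A nonvanishing condition on matrices of linear forms gives one on parameter
    points: a multihomogeneous part of the equation that does not vanish at
    [c] stays visible after scaling the entries of [c] by independent variables.
      *)
Lemma nonvanishing_general (k : fieldType) d (h : {mpoly k[#|{: 'I_d.+1 * 'I_d *
  'I_d}|]})
    (P : forall K : fieldType, 'M[{mpoly K[d]}]_(d.+1, d) -> Prop) :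
  (0 < d)%N -> h != 0 ->
  (forall (K : fieldType) (iota : {rmorphism k -> K}) c,
     coef_eval iota c h != 0 -> P K (linear_matrix c)) ->
  general_linear_matrix k P.
Proof.
move=> d0 h0 hP; pose h1 := multidegree_part h (multidegree (mlead h)).
have h10 : h1 != 0.
  have hl : h1@_(mlead h) != 0 by rewrite mcoeff_multidegree_part eqxx
    mleadc_eq0.
  by apply: contraNneq hl => ->; rewrite mcoeff0.
pose nonvanishing g : pointset k d := fun K iota c =>
  coordinates c /\ coef_eval iota c g != 0.
have nonvanishing_open (H : _ -> Prop) g : H g -> zariski_open H (nonvanishing
  g).
  move=> Hg; exists (fun g' => g' = g) => [g' ->//|K iota c].
  by split=> [[cc gc]|[cc [_ -> gc]]]; split=> //; exists g.
exists (nonvanishing h1), (nonvanishing h); split.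
- split; first exact/nonvanishing_open/multidegree_part_multihomogeneous.
  by apply: (nonvanishing_dense d0 h10) => K iota c cc hc; split.
- split; first exact: nonvanishing_open.
  by apply: (nonvanishing_dense d0 h0) => K iota c cc hc; split.
- move=> K iota c [cc hc].
  exists _, (scaling_tau d K), (scaled_coefs c); split; first exact:
    scaled_same_point.
  split; first exact: scaled_coordinates.
  rewrite coef_eval_scaled tofrac_eq0.
  apply: contraNneq hc => s0; rewrite -(mcoeff_scaled_value iota c h) s0.
  by rewrite mcoeff0.
- by move=> K iota c [_ hc]; apply: hP hc.
Qed.

Lemma lead_coef_top (A : nzRingType) (g : {poly A}) m :
  (size g <= m.+1)%N -> g`_m != 0 -> lead_coef g = g`_m.
Proof.
move=> sg gm; rewrite lead_coefE; have -> // : size g = m.+1.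
by apply/eqP; rewrite eqn_leq sg ltnNge; apply: contra gm => /leq_sizeP->.
Qed.

Section LineCondition.
Variables (k : fieldType) (n : nat).
Local Notation d := n.+3.
Local Notation cpoly := {mpoly k[#|{: 'I_d.+1 * 'I_d * 'I_d}|]}.
Local Notation u := (@ord0 n.+2).
Local Notation v := (@ord_max n.+2).
Local Notation N := (d * (d - 1) - 1)%N.
Local Notation gen := (generic_coefs k d).

Let fgen j : {poly cpoly} := line_factor gen u v j.
Let qgen := fgen (lift ord0 ord0).
Let pgen := fgen ord0 + qgen.

Definition line_condition : cpoly :=
  \det (minor_coefs gen u v) * \prod_j lead_coef (fgen j)
  * (pgen`_N * qgen`_N * resultant pgen qgen).

Let coef_eval_factor (K : fieldType) (iota : {rmorphism k -> K}) c j :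
  line_factor c u v j = map_poly (coef_eval iota c) (fgen j).
Proof. by rewrite -map_line_factor coef_eval_generic. Qed.

Let coef_eval_sum (K : fieldType) (iota : {rmorphism k -> K}) c :
  line_factor c u v ord0 + line_factor c u v (lift ord0 ord0)
    = map_poly (coef_eval iota c) pgen.
Proof. by rewrite rmorphD /= !(coef_eval_factor iota). Qed.

(* The degree bound holds over fields: read it off at the generic point. *)
Let size_fgen j : (size (fgen j) <= N.+1)%N.
Proof.
have := size_line_factor (generic_point k d) j.
rewrite map_line_factor size_map_inj_poly ?rmorph0 //.
by move=> a b /eqP; rewrite -subr_eq0 -rmorphB tofrac_eq0 subr_eq0 => /eqP.
Qed.

Let resultant_eval (K : fieldType) (iota : {rmorphism k -> K}) c :
  coef_eval iota c pgen`_N != 0 -> coef_eval iota c qgen`_N != 0 ->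
  let q := line_factor c u v (lift ord0 ord0) in
  let p := line_factor c u v ord0 + q in
  coef_eval iota c (resultant pgen qgen) = resultant p q.
Proof.
move=> pN qN q p.
have sp : (size pgen <= N.+1)%N.
  by rewrite (leq_trans (size_polyD _ _)) // geq_max !size_fgen.
have lp : lead_coef pgen = pgen`_N.
  by apply: (lead_coef_top sp); apply: contraNneq pN => ->; rewrite rmorph0.
have lq : lead_coef qgen = qgen`_N.
  by apply: (lead_coef_top (size_fgen _)); apply: contraNneq qN => ->; rewrite
    rmorph0.
rewrite map_resultant_rmorphism ?lp ?lq // /p /q (coef_eval_sum iota).
by rewrite (coef_eval_factor iota).
Qed.

Lemma line_condition_general (K : fieldType) (iota : {rmorphism k -> K}) c :
  coef_eval iota c line_condition != 0 -> line_general c.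
Proof.
rewrite /line_condition !rmorphM /= !mulf_eq0 !negb_or.
move=> /andP[/andP[mc lf] /andP[/andP[pN qN] res]].
split.
- move: mc; rewrite -det_map_mx -map_minor_coefs coef_eval_generic.
  by rewrite unitmxE unitfE.
- move=> j; rewrite (coef_eval_factor iota); apply: contraNneq lf => f0.
  rewrite rmorph_prod (bigD1 j) //= lead_coefE -coef_map f0 coef0.
  by apply/eqP; exact: mul0r.
- move=> /=; split.
  + by rewrite (coef_eval_sum iota) coef_map.
  + by rewrite (coef_eval_factor iota) coef_map.
  + by have := resultant_eval pN qN; move=> /= <-.
Qed.

Lemma line_condition_neq0 : line_condition != 0.
Proof.
pose iota : {rmorphism k -> k} := idfun.
have [mc lf [pN qN res]] := bidiagonal_line_general k n.
pose c := bidiagonal_coefs k n.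
rewrite (coef_eval_sum iota) coef_map in pN.
rewrite (coef_eval_factor iota) coef_map in qN.
have nz a : coef_eval iota c a != 0 -> a != 0.
  by apply: contraNneq => ->; rewrite rmorph0.
rewrite !mulf_neq0 //.
- apply: nz; rewrite -det_map_mx -map_minor_coefs coef_eval_generic.
  by rewrite -unitfE -unitmxE.
- apply/prodf_neq0 => j _; rewrite lead_coef_eq0; apply: contraNneq (lf j) =>
    f0.
  by rewrite (coef_eval_factor iota) f0 rmorph0.
- exact: nz pN.
- exact: nz qN.
- by apply: nz; rewrite resultant_eval.
Qed.

End LineCondition.

Theorem theorem2p4 (k : fieldType) (d : nat) (hd : (3 <= d)%N) :
  general_linear_matrix k
    (fun (K : fieldType) (L : 'M[{mpoly K[d]}]_(d.+1, d)) =>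
      homaloidal_like L /\
      (forall j : 'I_d, inverse_representative L (basic_representative L j)) /\
      exists D : 'I_d -> {mpoly K[d]},
        [/\ forall j, inversion_factor L (basic_representative L j) (D j),
            has_codim (ideal_gen D) 2
          & minimal_graded_free_resolution3 (ideal_gen D)
              (fun _ : 'I_d => (d * (d - 1) - 1)%N)
              (fun _ : 'I_d => (d ^ 2 - 1)%N)
              (fun _ : 'I_1 => (d ^ 2)%N)
              (\row_j D j) (Psi L) (\col_(i < d) 'X_i)]).
Proof.
case: d hd => [|[|[|n]]] // _.
refine (@nonvanishing_general k n.+3 (line_condition k n) _ isT
  (line_condition_neq0 k n) _).
move=> K iota c /line_condition_general gc.
exact: (line_general_resolution gc).
Qed.
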